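(* Let $\psi:\mathbb{R}^d\to(-\infty,\infty]$ be proper, closed, convex, bounded below with $\int e^{-\psi}<\infty$, $\pi\propto e^{-\psi}$, and for fixed $\lambda>0$ let $\pi^\lambda\propto e^{-\psi^\lambda}$ and $w^\lambda(x)=e^{-\{\psi(x)-\psi^\lambda(x)\}}$. Let $\xi:\mathbb{R}^d\to\mathbb{R}^p$ with $\theta=\mathbb{E}_\pi[\xi(X)]$ finite, and let $\{X_t\}_{t\ge1}$ be an irreducible, aperiodic, Harris recurrent Markov chain with stationary density $\pi^\lambda$ for which the matrix $$\Xi=\frac{1}{[\mathbb{E}_{\pi^\lambda}(w^\lambda(X_1))]^2}\begin{bmatrix}\mathbf I_p&-\theta\end{bmatrix}\Sigma\begin{bmatrix}\mathbf I_p\\-\theta^T\end{bmatrix},\quad \Sigma=\sum_{k=-\infty}^\infty\mathrm{Cov}_{\pi^\lambda}(S(X_1),S(X_{1+k})),\quad S(x)=\begin{pmatrix}\xi(x)w^\lambda(x)\\ w^\lambda(x)\end{pmatrix},$$ is well defined. Let $\hat\Sigma$ be an estimator of $\Sigma$ computed from $X_1,\dots,X_n$ that is strongly consistent, i.e. $\hat\Sigma\to\Sigma$ almost surely as $n\to\infty$, and define $$\hat\Xi_n=\frac{1}{\bar w_n^2}\begin{bmatrix}\mathbf I_p&-\hat\theta_n^{\mathrm{MY}}\end{bmatrix}\hat\Sigma\begin{bmatrix}\mathbf I_p\\-(\hat\theta_n^{\mathrm{MY}})^T\end{bmatrix},$$ where $\bar w_n=n^{-1}\sum_{t=1}^n w^\lambda(X_t)$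 and $\hat\theta_n^{\mathrm{MY}}=\sum_{t=1}^n\xi(X_t)w^\lambda(X_t)/\sum_{k=1}^n w^\lambda(X_k)$. Then $\hat\Xi_n\to\Xi$ almost surely as $n\to\infty$.
   Context: $\psi^\lambda(x)=\inf_y\{\psi(y)+\frac1{2\lambda}\|y-x\|^2\}$ is the Moreau-Yosida envelope of $\psi$; $\mathrm{Cov}_{\pi^\lambda}$ is covariance along the stationary chain. *)

(* Defs.v *)
From HB Require Import structures.
From mathcomp Require Import all_boot all_order all_algebra.
From mathcomp Require Import all_classical all_reals all_analysis.
Set Implicit Arguments. Unset Strict Implicit. Unset Printing Implicit Defensive.
Import Order.TTheory GRing.Theory Num.Theory.
Import numFieldNormedType.Exports.
Local Open Scope classical_set_scope.
Local Open Scope ring_scope.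

Section Defs.
Variables (R : realType) (d : nat).

Definition vec := 'rV[R]_d.
Definition Rd := g_sigma_algebraType (@open vec).

Definition sqnorm (v : vec) : R := \sum_(i < d) (v ord0 i) ^+ 2.

(* [m] is Lebesgue measure on the Borel sets of R^d: it gives to every closed
   box its volume (this characterises Lebesgue measure uniquely) *)
Definition is_lebesgue (m : {measure set Rd -> \bar R}) :=
  forall a b : vec,
    m [set x : Rd | forall i, a ord0 i <= (x : vec) ord0 i <= b ord0 i] =
    (\prod_(i < d) Num.max (b ord0 i - a ord0 i) 0)%:E.

Definition proper_fun (psi : Rd -> \bar R) :=
  (forall x, psi x != -oo%E) /\ exists x, psi x != +oo%E.
Definition closed_fun (psi : Rd -> \bar R) :=
  closed [set xy : vec * R | (psi xy.1 <= xy.2%:E)%E].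
Definition convex_fun (psi : Rd -> \bar R) :=
  forall (x y : vec) (t : R), 0 <= t <= 1 ->
    (psi ((t *: x + (1 - t) *: y)%R : vec) <= t%:E * psi x + (1 - t)%:E * psi y)%E.
Definition bounded_below (psi : Rd -> \bar R) :=
  exists c : R, forall x, (c%:E <= psi x)%E.

Definition moreau (psi : Rd -> \bar R) (lam : R) (x : Rd) : \bar R :=
  ereal_inf [set (psi y + (sqnorm ((y : vec) - (x : vec)) / (2 * lam))%:E)%E
            | y in [set: Rd]].

Definition wlam (psi : Rd -> \bar R) (lam : R) (x : Rd) : R :=
  fine (expeR (- (psi x - moreau psi lam x)))%E.

Definition dens (psi : Rd -> \bar R) (x : Rd) : R := fine (expeR (- psi x)).
Definition dens_lam (psi : Rd -> \bar R) (lam : R) (x : Rd) : R :=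
  expR (- fine (moreau psi lam x)).

Definition Edens (m : {measure set Rd -> \bar R}) (g f : Rd -> R) : R :=
  Rintegral m setT (fun x => f x * g x) / Rintegral m setT g.

Definition Kop (K : R.-pker Rd ~> Rd) (f : Rd -> R) (x : Rd) : R :=
  Rintegral (K x) setT f.
Definition KopE (K : R.-pker Rd ~> Rd) (f : Rd -> \bar R) (x : Rd) : \bar R :=
  (\int[K x]_y f y)%E.

(* P_x(tau_A <= N), tau_A = first hitting time of A at times >= 1 *)
Fixpoint hit (K : R.-pker Rd ~> Rd) (A : set Rd) (N : nat) : Rd -> \bar R :=
  match N with
  | 0%N => fun _ => 0%E
  | N'.+1 => fun x =>
      (\int[K x]_y ((\1_A y)%:E + (\1_(~` A) y)%:E * hit K A N' y))%E
  end.
(* L(x,A) = P_x(tau_A < oo) *)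
Definition Lret (K : R.-pker Rd ~> Rd) (A : set Rd) (x : Rd) : \bar R :=
  ereal_sup (range (fun N => hit K A N x)).
(* Q(x,A) = P_x(eta_A = oo) = lim_m P_x(some visit to A after time m)
          = inf_m \int K^m(x,dy) L(y,A) *)
Definition Qinf (K : R.-pker Rd ~> Rd) (A : set Rd) (x : Rd) : \bar R :=
  ereal_inf (range (fun m => iter m (KopE K) (Lret K A) x)).

Definition irreducible_wrt (K : R.-pker Rd ~> Rd) (phi : {measure set Rd -> \bar R}) :=
  (0 < phi setT)%E /\
  forall A, measurable A -> (0 < phi A)%E -> forall x, (0 < Lret K A x)%E.
Definition irreducible (K : R.-pker Rd ~> Rd) :=
  exists phi : {measure set Rd -> \bar R}, irreducible_wrt K phi.
Definition harris_recurrent (K : R.-pker Rd ~> Rd) :=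
  exists phi : {measure set Rd -> \bar R}, irreducible_wrt K phi /\
  forall A, measurable A -> (0 < phi A)%E -> forall x, Qinf K A x = 1%E.
(* aperiodicity (Roberts-Rosenthal): no cycle D_0 -> D_1 -> ... -> D_(k-1)
   -> D_0, k >= 2, of disjoint sets with pi(D_0) > 0 *)
Definition aperiodic (K : R.-pker Rd ~> Rd) (pi : set Rd -> \bar R) :=
  ~ exists (k : nat) (D : 'I_k.+2 -> set Rd),
      [/\ (forall i, measurable (D i)),
          (forall i j, i != j -> D i `&` D j = set0),
          (0 < pi (D ord0))%E &
          forall i x, D i x -> K x (D (ordS i)) = 1%E].

Definition stationary_dens (m : {measure set Rd -> \bar R}) (K : R.-pker Rd ~> Rd)
    (g : Rd -> R) :=
  forall A, measurable A ->
    (\int[m]_x ((g x)%:E * K x A) = \int[m]_(x in A) (g x)%:E)%E.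

(* finite-dimensional distributions of a chain with kernel K:
   P(X_0 in A_0, ..., X_n in A_n) = E[fdd K [:: A_0; ..; A_n] (X_0)] *)
Fixpoint fdd (K : R.-pker Rd ~> Rd) (As : seq (set Rd)) : Rd -> \bar R :=
  match As with
  | [::] => fun _ => 1%E
  | A :: As' => fun x => ((\1_A x)%:E * \int[K x]_y fdd K As' y)%E
  end.

Definition markov_chain {dO} {O : measurableType dO} (P : probability O R)
    (X : nat -> O -> Rd) (K : R.-pker Rd ~> Rd) :=
  (forall t, measurable_fun setT (X t)) /\
  forall As : seq (set Rd), (forall i, (i < size As)%N -> measurable (nth set0 As i)) ->
    P [set w | forall i, (i < size As)%N -> nth set0 As i (X i w)] =
    (\int[P]_w fdd K As (X 0%N w))%E.

Variable p : nat.

Definition Amat (v : 'cV[R]_p) : 'M[R]_(p, p + 1) := row_mx 1%:M (- v).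

Definition Svec (psi : Rd -> \bar R) (lam : R) (xi : Rd -> 'cV[R]_p) (x : Rd)
  : 'cV[R]_(p + 1) := col_mx (wlam psi lam x *: xi x) (wlam psi lam x)%:M.

(* lag-k autocovariance Cov_{pi^lam}(S(X_1), S(X_{1+k})), k >= 0,
   along the stationary chain with kernel K *)
Definition Cov_lag (m : {measure set Rd -> \bar R}) (K : R.-pker Rd ~> Rd)
    (psi : Rd -> \bar R) (lam : R) (xi : Rd -> 'cV[R]_p) (k : nat)
  : 'M[R]_(p + 1) :=
  let E := Edens m (dens_lam psi lam) in
  let S i x := Svec psi lam xi x i ord0 in
  \matrix_(i, j) (E (fun x => S i x * iter k (Kop K) (S j) x) - E (S i) * E (S j)).

(* symmetric partial sums \sum_{k=-n}^{n} Cov(S(X_1), S(X_{1+k})) *)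
Definition Sigma_partial m K psi lam xi (n : nat) : 'M[R]_(p + 1) :=
  Cov_lag m K psi lam xi 0 +
  \sum_(1 <= k < n.+1) (Cov_lag m K psi lam xi k + (Cov_lag m K psi lam xi k)^T).

End Defs.

(* Main.v *)
Require Import Defs.
From HB Require Import structures.
From mathcomp Require Import all_boot all_order all_algebra.
From mathcomp Require Import all_classical all_reals all_analysis.
From mathcomp Require Import measurable_realfun zify ring lra.
Import Order.TTheory GRing.Theory Num.Theory.
Set Implicit Arguments. Unset Strict Implicit. Unset Printing Implicit Defensive.
Import numFieldNormedType.Exports HBNNSimple.
Local Open Scope classical_set_scope.
Local Open Scope ring_scope.

(* Everything reduces to a strong law, for an arbitrary initial law, for each
   coordinate f of S: since w^lambda * pi^lambda is proportional to pi, the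
   averages then give wbar_n -> E(w) and thetahat_n -> theta, and Xihat_n is a
   continuous function of these and of the estimator of Sigma.

   The strong law is proved in L^2. Let g = f - E(f). Convergence of the series
   defining Sigma bounds the stationary variance of g(X_1) + ... + g(X_N) by a
   multiple of N. Along N = n^2 these variances, divided by N^2, are summable,
   and so are the contributions of the blocks between consecutive squares. The
   sum of all these second moments for the chain started at x is a function
   G(x) with finite stationary mean, so A = {G < oo} has full stationary
   measure, and from every point of A averages of g tend to 0 almost surely.
   By Harris recurrence the chain enters A almost surely from any starting
   point. To make sense of signed moments at a fixed starting point, all
   functions are dominated by the Lyapunov function
   U = sum_t 2^-t K^t (1 + g^2), which satisfies K U <= 2 U. *)

(** The rates force the passage to squares. A variance bound of order N leaves 1/N after division by
    N^2, which is not summable, whereas N = n^2 leaves n^-2. Between consecutive squares lie at most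
    3n terms, so by Cauchy-Schwarz the squared sum of a piece of a block is at most 3n times the sum
    of squares over the block, whose mean is of order n; divided by n^4 this is again of order n^-2.
    The variance bound itself needs only bounded partial sums c_0 + 2 (c_1 + ... + c_n), because the
    stationary second moment of N terms is a sum of N of them.

    The other obstacle is that [Kop] is a real-valued integral with a default value where the
    integrand is not integrable, so its linearity can fail at some points. It holds for dominated
    functions where U is finite, and K U <= 2 U makes {U < oo} absorbing: from a point of this set,
    K stays in it almost surely. Identities between iterates of [Kop] are thus proved on {U < oo}
    only, and pass to integrals because U is integrable, hence finite almost everywhere. *)

(** A nonnegative measurable function is an increasing limit of finite sums of scaled indicators of
    its level sets. The closure hypotheses carry nonnegativity and measurability because the
    integral identities proved with this principle rely on additivity and monotone convergence. *)
Lemma ge0_measurable_ind d (T : measurableType d) (R : realType)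
    (Pr : (T -> \bar R) -> Prop) :
  (forall A, measurable A -> Pr (fun x => (\1_A x)%:E)) ->
  (forall (c : R) (h : T -> \bar R), 0 <= c -> (forall x, (0 <= h x)%E) ->
     measurable_fun setT h -> Pr h -> Pr (fun x => c%:E * h x)%E) ->
  (forall h1 h2 : T -> \bar R, (forall x, (0 <= h1 x)%E) ->
     (forall x, (0 <= h2 x)%E) ->
     measurable_fun setT h1 -> measurable_fun setT h2 -> Pr h1 -> Pr h2 ->
     Pr (fun x => h1 x + h2 x)%E) ->
  (forall h : nat -> T -> \bar R, (forall n x, (0 <= h n x)%E) ->
     (forall n, measurable_fun setT (h n)) ->
     (forall x, nondecreasing_seq (h ^~ x)) ->
     (forall n, Pr (h n)) -> Pr (fun x => limn (h ^~ x))) ->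
  forall h : T -> \bar R, (forall x, (0 <= h x)%E) -> measurable_fun setT h -> Pr h.
Proof.
move=> P1 PZ PD PL h h0 mh.
pose f_ := nnsfun_approx measurableT mh.
have -> : h = (fun x => limn (fun n => (f_ n x)%:E)).
  apply/funext => x; apply/esym/cvg_lim => //.
  exact: (cvg_nnsfun_approx measurableT mh (fun x _ => h0 x) (Logic.I : setT x)).
apply: (PL (fun n x => (f_ n x)%:E)).
- by move=> n x; rewrite lee_fin.
- by move=> n; exact/measurable_EFinP/measurable_funP.
- by move=> x m n mn; rewrite lee_fin; exact/lefP/nd_nnsfun_approx.
move=> n.
have mfr r : measurable (f_ n @^-1` [set r]).
  by rewrite -[X in measurable X]setTI; exact: measurable_funP.
pose s := finmap.enum_fset (fset_set (range (f_ n))).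
have sge0 r : r \in s -> 0 <= r.
  move=> /=; rewrite /s in_fset_set; last exact: fimfunP.
  by rewrite inE => -[x _ <-]; exact: fun_ge0.
have -> : (fun x => (f_ n x)%:E) =
    (fun x => \sum_(r <- s) (r%:E * (\1_(f_ n @^-1` [set r]) x)%:E))%E.
  apply/funext => x; rewrite fimfunE fsbig_finite/=; last exact: fimfunP.
  by rewrite -sumEFin; apply: eq_bigr => r _; rewrite EFinM.
elim: s sge0 => [|r s IH] s0.
  under eq_fun do rewrite big_nil.
  have := P1 set0 measurable0.
  by under eq_fun do rewrite indicE in_set0.
under eq_fun do rewrite big_cons.
have r0 : 0 <= r by apply: s0; rewrite mem_head.
have s0' r' : r' \in s -> 0 <= r' by move=> r's; apply: s0; rewrite inE r's orbT.
apply: (PD (fun x => r%:E * (\1_(f_ n @^-1` [set r]) x)%:E)%E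
           (fun x => \sum_(j <- s) j%:E * (\1_(f_ n @^-1` [set j]) x)%:E)%E).
- by move=> x; rewrite mule_ge0// lee_fin.
- move=> x; rewrite big_seq; apply: sume_ge0 => j js.
  by rewrite mule_ge0// lee_fin // s0'.
- by apply: measurable_funeM; exact/measurable_EFinP/measurable_indic.
- apply: emeasurable_sum => j.
  by apply: measurable_funeM; exact/measurable_EFinP/measurable_indic.
- apply: PZ => //; last exact: P1.
  exact/measurable_EFinP/measurable_indic.
- exact: IH.
Qed.

(** * Nonnegative functions along the chain *)

Section kernel_operator.
Context {R : realType} {d : nat}.
Notation E := (Rd R d).
Variable K : R.-pker E ~> E.
Implicit Types h : E -> \bar R.

Lemma KopE_ge0 h : (forall x, (0 <= h x)%E) -> forall x, (0 <= KopE K h x)%E.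
Proof. by move=> h0 x; apply: integral_ge0 => y _; exact: h0. Qed.

Lemma measurable_KopE h : (forall x, (0 <= h x)%E) -> measurable_fun setT h ->
  measurable_fun setT (KopE K h).
Proof.
move=> h0 mh; apply: measurable_fun_integral_kernel => //.
by move=> U mU; exact: measurable_kernel.
Qed.

Lemma le_KopE h1 h2 : (forall x, (0 <= h1 x)%E) -> measurable_fun setT h1 ->
  measurable_fun setT h2 ->
  (forall x, (h1 x <= h2 x)%E) -> forall x, (KopE K h1 x <= KopE K h2 x)%E.
Proof.
by move=> h10 m1 m2 h12 x; apply: ge0_le_integral.
Qed.

Lemma iter_KopE_ge0 k h : (forall x, (0 <= h x)%E) ->
  forall x, (0 <= iter k (KopE K) h x)%E.
Proof. by move=> h0; elim: k => //= k IH; exact: KopE_ge0. Qed.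

Lemma measurable_iter_KopE k h : (forall x, (0 <= h x)%E) ->
  measurable_fun setT h -> measurable_fun setT (iter k (KopE K) h).
Proof.
move=> h0 mh; elim: k => //= k IH; apply: measurable_KopE => //.
exact: iter_KopE_ge0.
Qed.

Lemma KopE_indic A : measurable A ->
  KopE K (fun y => (\1_A y)%:E) = K ^~ A.
Proof.
by move=> mA; apply/funext => x; rewrite /KopE integral_indic// setIT.
Qed.

Lemma KopE_cst c x : KopE K (fun _ => c%:E) x = c%:E.
Proof. by rewrite /KopE integral_cst// prob_kernel mule1. Qed.

Lemma fdd_ge0 As x : (0 <= fdd K As x)%E.
Proof.
elim: As x => //= A As IH x; apply: mule_ge0; first by rewrite lee_fin.
by apply: integral_ge0 => y _; exact: IH.
Qed.

Lemma measurable_fdd As :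
  (forall i, (i < size As)%N -> measurable (nth set0 As i)) ->
  measurable_fun setT (fdd K As).
Proof.
elim: As => [_|A As IH mA] /=; first exact: measurable_cst.
apply: emeasurable_funM.
  by apply/measurable_EFinP/measurable_indic; exact: (mA 0%N).
apply: measurable_KopE; first exact: fdd_ge0.
by apply: IH => i iAs; exact: (mA i.+1).
Qed.

(** * Invariant measures *)

Variable mu : {measure set E -> \bar R}.
Hypothesis Kmu : forall A, measurable A -> (\int[mu]_x K x A = mu A)%E.

Lemma integral_KopE h : (forall x, (0 <= h x)%E) -> measurable_fun setT h ->
  (\int[mu]_x KopE K h x = \int[mu]_x h x)%E.
Proof.
apply: (@ge0_measurable_ind _ E R
  (fun h => \int[mu]_x KopE K h x = \int[mu]_x h x)%E).
- move=> A mA; rewrite integral_indic// setIT -Kmu//.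
  by apply: eq_integral => x _; rewrite KopE_indic.
- move=> c u c0 u0 mu_ IH.
  under eq_integral do rewrite /KopE ge0_integralZl//.
  rewrite ge0_integralZl//; [|exact: measurable_KopE|by move=> x _; exact: KopE_ge0].
  by rewrite IH ge0_integralZl.
- move=> u v u0 v0 mu_ mv IHu IHv.
  under eq_integral do rewrite /KopE ge0_integralD//.
  rewrite ge0_integralD//;
    [|by move=> x _; exact: KopE_ge0|exact: measurable_KopE
     |by move=> x _; exact: KopE_ge0|exact: measurable_KopE].
  by rewrite [X in (X + _)%E]IHu [X in (_ + X)%E]IHv ge0_integralD.
- move=> u u0 mu_ ndu IH.
  rewrite [RHS]monotone_convergence//.
  under [in RHS]eq_fun do rewrite -IH.
  rewrite -monotone_convergence//.
  + apply: eq_integral => x _; rewrite /KopE monotone_convergence//.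
  + by move=> n; apply: measurable_KopE.
  + by move=> n x _; exact: KopE_ge0.
  + by move=> x _ m n mn; apply: le_KopE => // y; exact: ndu.
Qed.

Lemma integral_iter_KopE k h : (forall x, (0 <= h x)%E) ->
  measurable_fun setT h ->
  (\int[mu]_x iter k (KopE K) h x = \int[mu]_x h x)%E.
Proof.
move=> h0 mh; elim: k => //= k IH; rewrite integral_KopE//.
- exact: iter_KopE_ge0.
- exact: measurable_iter_KopE.
Qed.

End kernel_operator.

(** The content is v = +oo, where multiplication is not continuous. If the limit is 0 then every
    term is 0 and 0 * oo = 0 on both sides; otherwise the terms are eventually positive and both
    sides are +oo. *)
Lemma nd_limeMr (R : realType) (u : nat -> \bar R) (v : \bar R) :
  (forall n, (0 <= u n)%E) -> nondecreasing_seq u -> (0 <= v)%E ->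
  limn (fun n => u n * v)%E = (limn u * v)%E.
Proof.
move=> u0 ndu; have cu := ereal_nondecreasing_is_cvgn ndu.
case: v => [v _| _|//]; first by rewrite limeMr.
have ul n : (u n <= limn u)%E.
  rewrite (cvg_lim _ (ereal_nondecreasing_cvgn ndu))//.
  by apply: ereal_sup_ubound; exists n.
have [l0|l0] := eqVneq (limn u) 0%E.
  rewrite l0 mul0e (_ : (fun _ => _) = cst 0%E) ?lim_cst//.
  apply/funext => n; rewrite (_ : u n = 0%E) ?mul0e//.
  by apply/eqP; rewrite eq_le u0 -l0 ul.
have lgt0 : (0 < limn u)%E by rewrite lt0e l0 (le_trans (u0 0%N))// ul.
have [n un] : exists n, (0 < u n)%E.
  apply: contrapT => /forallNP H; move: lgt0; apply/negP; rewrite -leNgt.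
  apply: lime_le => //; apply: nearW => n; rewrite leNgt.
  by apply/negP; exact: H.
rewrite gt0_muley//; apply/cvg_lim => //; apply: cvg_near_cst.
exists n => // m /= nm; rewrite gt0_muley// (lt_le_trans un)//.
exact: ndu.
Qed.

(** * The Markov property on an event *)

Section markov_on.
Context {R : realType} {d : nat}.
Notation E := (Rd R d).
Variable K : R.-pker E ~> E.
Context {dO : measure_display} {O : measurableType dO} (P : probability O R).
Implicit Types (D : set O) (Y : nat -> O -> E) (h a : E -> \bar R).

(* On the event [D], the process [Y] is a Markov chain with kernel [K]; unlike
   [markov_chain] this is preserved by time shifts and by conditioning on the
   initial state. *)
Definition markov_on D Y :=
  [/\ measurable D, (forall t, measurable_fun setT (Y t)) &
   forall As : seq (set E),
     (forall i, (i < size As)%N -> measurable (nth set0 As i)) ->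
     (P (D `&` [set w | forall i, (i < size As)%N -> nth set0 As i (Y i w)]) =
      \int[P]_(w in D) fdd K As (Y 0%N w))%E].

Lemma markov_chain_on X : markov_chain P X K -> markov_on setT X.
Proof. by move=> [mX HX]; split => // As mAs; rewrite setTI HX. Qed.

Lemma measurable_comp_state Y t h : (forall t, measurable_fun setT (Y t)) ->
  measurable_fun setT h -> measurable_fun setT (fun w => h (Y t w)).
Proof. by move=> mY mh; exact: measurableT_comp. Qed.

(** A condition on the initial state can be absorbed into the first set of a cylinder, replacing A0
    by the intersection of [A] and A0. *)
Lemma markov_on_init D Y A : measurable A -> markov_on D Y ->
  markov_on (D `&` Y 0%N @^-1` A) Y.
Proof.
move=> mA [mD mY HY].
have mYA : measurable (Y 0%N @^-1` A).
  by rewrite -[X in measurable X]setTI; exact: mY.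
split => //; first exact: measurableI.
(* The empty cylinder has no first set to intersect with [A]; there both sides are the probability
   of the event. *)
move=> [|A0 As] mAs.
  rewrite integral_cst ?mul1e; last exact: measurableI.
  by congr (P _); apply/seteqP; split => [w []//|w]; split.
rewrite integral_mkcondr.
transitivity (P (D `&` [set w | forall i, (i < size ((A `&` A0) :: As))%N ->
    nth set0 ((A `&` A0) :: As) i (Y i w)])).
  congr (P _); apply/seteqP; split => w /=.
    move=> [[Dw Aw] H]; split => // -[_|i] //=; first by split => //; exact: (H 0%N).
    exact: (H i.+1).
  move=> [Dw H]; have [AY A0Y] := H 0%N isT.
  by split => // -[|i] // iAs; exact: (H i.+1).
rewrite HY; last first.
  by move=> [_|i] /=; [apply: measurableI => //; exact: (mAs 0%N)|exact: (mAs i.+1)].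
apply: eq_integral => w _ /=; rewrite patchE indicI.
case: ifPn => /=.
  by rewrite inE => Aw; rewrite !indicE !(mem_set (A := A))//= mul1r.
rewrite notin_setE => Aw; rewrite !indicE memNset//= mul0r mul0e//.
Qed.

Lemma integral_markov_step D Y h : markov_on D Y -> (forall x, (0 <= h x)%E) ->
  measurable_fun setT h ->
  (\int[P]_(w in D) h (Y 1%N w) = \int[P]_(w in D) KopE K h (Y 0%N w))%E.
Proof.
move=> [mD mY HY].
have mYD t (u : E -> \bar R) : measurable_fun setT u -> measurable_fun D (fun w => u (Y t w)).
  by move=> mu_; apply: measurable_funTS; exact: (measurable_comp_state t mY mu_).
apply: (@ge0_measurable_ind _ E R (fun h => \int[P]_(w in D) h (Y 1%N w) =
  \int[P]_(w in D) KopE K h (Y 0%N w))%E).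
- move=> A mA.
  have mYA : measurable (Y 1%N @^-1` A).
    by rewrite -[X in measurable X]setTI; exact: mY.
  transitivity (P (D `&` Y 1%N @^-1` A)).
    by rewrite setIC -(integral_indic P mD mYA).
  transitivity (P (D `&` [set w | forall i, (i < size [:: setT; A])%N ->
      nth set0 [:: setT; A] i (Y i w)])).
    congr (P _); apply/seteqP; split => w /= [Dw H]; split => //.
      by move=> [|[|i]].
    exact: (H 1%N).
  rewrite HY; last by move=> [|[|i]] //=.
  apply: eq_integral => w _ /=; rewrite indicT mul1e; apply: eq_integral => y _.
  by rewrite integral_cst// prob_kernel !mule1.
- move=> c u c0 u0 mu_ IH.
  under [RHS]eq_integral do rewrite /KopE ge0_integralZl//.
  rewrite !ge0_integralZl//.
  + by rewrite IH.
  + exact: (mYD 1%N).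
  + by apply: (mYD 0%N (KopE K u)); exact: measurable_KopE.
  + by move=> w _; exact: KopE_ge0.
- move=> u v u0 v0 mu_ mv IHu IHv.
  under [RHS]eq_integral do rewrite /KopE ge0_integralD//.
  rewrite [LHS]ge0_integralD// 1?[RHS]ge0_integralD//; first by rewrite IHu IHv.
  all: try by [move=> w _; exact: KopE_ge0|exact: (mYD 1%N)
    |apply: (mYD 0%N (KopE K u)); exact: measurable_KopE
    |apply: (mYD 0%N (KopE K v)); exact: measurable_KopE].
- move=> u u0 mu_ ndu IH.
  rewrite monotone_convergence//; first last.
    by move=> n; exact: (mYD 1%N).
  under eq_fun do rewrite IH.
  rewrite -monotone_convergence//; first last.
  + by move=> x _ m n mn; apply: le_KopE => // y; exact: ndu.
  + by move=> n x _; exact: KopE_ge0.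
  + by move=> n; apply: (mYD 0%N (KopE K (u n))); exact: measurable_KopE.
  apply: eq_integral => x _; rewrite /KopE monotone_convergence//.
Qed.

(** A cylinder for the shifted process is the cylinder [setT :: As] for the original one, and the
    kernel [K] that this prefix adds to [fdd] is the one that carries an integral at time 1 back to
    time 0. *)
Lemma markov_on_shift D Y : markov_on D Y -> markov_on D (fun t => Y t.+1).
Proof.
move=> HDY; have [mD mY HY] := HDY; split => // As mAs.
rewrite (integral_markov_step HDY); [|exact: fdd_ge0|exact: measurable_fdd].
transitivity (\int[P]_(w in D) fdd K (setT :: As) (Y 0%N w))%E; last first.
  by apply: eq_integral => w _ /=; rewrite indicT mul1e.
rewrite -HY; last by case=> //= i; exact: mAs.
congr (P _); apply/seteqP; split => w [Dw H]; split => //.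
  by case=> //= i; exact: H.
by move=> i iAs; exact: (H i.+1).
Qed.

Lemma integral_markov_iter k D Y h : markov_on D Y ->
  (forall x, (0 <= h x)%E) -> measurable_fun setT h ->
  (\int[P]_(w in D) h (Y k w) =
   \int[P]_(w in D) iter k (KopE K) h (Y 0%N w))%E.
Proof.
move=> HDY h0 mh; elim: k Y HDY => //= k IH Y HDY.
rewrite -(integral_markov_step HDY).
- exact: (IH _ (markov_on_shift HDY)).
- exact: iter_KopE_ge0.
- exact: measurable_iter_KopE.
Qed.

(** When [a] is an indicator, the factor a(Y_0) is a restriction to an event on the initial state,
    on which the process is still Markov by [markov_on_init]. The general [a] follows by
    approximation. *)
Lemma integral_markov_iter2 k D Y a h : markov_on D Y ->
  (forall x, (0 <= a x)%E) -> measurable_fun setT a ->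
  (forall x, (0 <= h x)%E) -> measurable_fun setT h ->
  (\int[P]_(w in D) (a (Y 0%N w) * h (Y k w)) =
   \int[P]_(w in D) (a (Y 0%N w) * iter k (KopE K) h (Y 0%N w)))%E.
Proof.
move=> HDY + + h0 mh; have [mD mY HY] := HDY.
pose h' := iter k (KopE K) h.
have h'0 x : (0 <= h' x)%E by exact: iter_KopE_ge0.
have mh' : measurable_fun setT h' by exact: measurable_iter_KopE.
have mYD t (u : E -> \bar R) : measurable_fun setT u -> measurable_fun D (fun w => u (Y t w)).
  by move=> mu_; apply: measurable_funTS; exact: (measurable_comp_state t mY mu_).
have mh1 := mYD k h mh; have mh2 := mYD 0%N h' mh'.
apply: (@ge0_measurable_ind _ E R (fun a =>
  \int[P]_(w in D) (a (Y 0%N w) * h (Y k w)) =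
  \int[P]_(w in D) (a (Y 0%N w) * h' (Y 0%N w)))%E).
- move=> A mA.
  have indA (v : O -> \bar R) : (\int[P]_(w in D) ((\1_A (Y 0%N w))%:E * v w) =
      \int[P]_(w in D `&` Y 0%N @^-1` A) v w)%E.
    rewrite integral_mkcondr; apply: eq_integral => w _; rewrite patchE indicE.
    have -> : (w \in Y 0%N @^-1` A) = (Y 0%N w \in A).
      by apply/idP/idP; rewrite !inE.
    by case: ifP => _ /=; rewrite ?mul1e ?mul0e.
  by rewrite !indA (integral_markov_iter k (markov_on_init mA HDY)).
- move=> c u c0 u0 mu_ IH.
  under eq_integral do rewrite -muleA.
  under [RHS]eq_integral do rewrite -muleA.
  rewrite ge0_integralZl// 1?[RHS]ge0_integralZl// ?IH//.
  all: try by [move=> w _; rewrite mule_ge0|apply: emeasurable_funM => //; exact: mYD].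
- move=> u v u0 v0 mu_ mv IHu IHv.
  under eq_integral do rewrite ge0_muleDl//.
  under [RHS]eq_integral do rewrite ge0_muleDl//.
  rewrite [LHS]ge0_integralD// 1?[RHS]ge0_integralD// ?IHu ?IHv//.
  all: try by [move=> w _; rewrite mule_ge0|apply: emeasurable_funM => //; exact: mYD].
- move=> u u0 mu_ ndu IH.
  have lim_mul (v : O -> \bar R) : (forall w, (0 <= v w)%E) -> measurable_fun D v ->
      (\int[P]_(w in D) (limn (u ^~ (Y 0%N w)) * v w) =
       limn (fun n => \int[P]_(w in D) (u n (Y 0%N w) * v w)))%E.
    move=> v0 mv; rewrite -monotone_convergence//.
    + by apply: eq_integral => w _; rewrite nd_limeMr.
    + by move=> n; apply: emeasurable_funM => //; exact: (mYD 0%N (u n)).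
    + by move=> n w _; rewrite mule_ge0.
    + by move=> w _ m n mn; rewrite lee_wpmul2r// ndu.
  rewrite !lim_mul//.
  by under eq_fun do rewrite IH.
Qed.

End markov_on.

(** * Recurrence *)

Section recurrence.
Context {R : realType} {d : nat}.
Notation E := (Rd R d).
Variable K : R.-pker E ~> E.
Implicit Types A : set E.

Let measurable_indicE A : measurable A ->
  measurable_fun setT (fun y : E => (\1_A y)%:E : \bar R).
Proof. by move=> mA; exact/measurable_EFinP/measurable_indic. Qed.

Lemma hit_ge0 A N x : (0 <= hit K A N x)%E.
Proof.
elim: N x => //= N IH x; apply: integral_ge0 => y _.
by rewrite adde_ge0 ?mule_ge0// lee_fin.
Qed.

Lemma measurable_hit A N : measurable A -> measurable_fun setT (hit K A N).
Proof.
move=> mA; elim: N => [|N IH] /=; first exact: measurable_cst.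
apply: (measurable_KopE K
  (h := fun y => ((\1_A y)%:E + (\1_(~` A) y)%:E * hit K A N y)%E)).
  by move=> y; rewrite adde_ge0 ?mule_ge0 ?hit_ge0// lee_fin.
apply: emeasurable_funD; first exact: measurable_indicE.
by apply: emeasurable_funM => //; apply: measurable_indicE; exact: measurableC.
Qed.

Lemma nondecreasing_hit A x : measurable A ->
  nondecreasing_seq (fun N => hit K A N x).
Proof.
move=> mA; apply/nondecreasing_seqP => N; elim: N x => [|N IH] x.
  exact: hit_ge0.
have m n : measurable_fun setT
    (fun y => ((\1_A y)%:E + (\1_(~` A) y)%:E * hit K A n y)%E).
  apply: emeasurable_funD; first exact: measurable_indicE.
  apply: emeasurable_funM; last exact: measurable_hit.
  by apply: measurable_indicE; exact: measurableC.
apply: (le_KopE K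
  (h1 := fun y => ((\1_A y)%:E + (\1_(~` A) y)%:E * hit K A N y)%E)
  (h2 := fun y => ((\1_A y)%:E + (\1_(~` A) y)%:E * hit K A N.+1 y)%E)) => //.
  by move=> y; rewrite adde_ge0 ?mule_ge0 ?hit_ge0// lee_fin.
by move=> y; rewrite leeD2l// lee_wpmul2l// lee_fin.
Qed.

(** Hitting [A] and avoiding it during times 1 to N are complementary. This links the recursion
    [hit], in which recurrence is phrased, to the cylinder probabilities that describe the chain.
    The outer [KopE] appears because [fdd] constrains the current state, while [hit] starts counting
    one step later. *)
Lemma hit_fdd A N x : measurable A ->
  (hit K A N x + KopE K (fdd K (nseq N (~` A))) x = 1)%E.
Proof.
move=> mA; have mAC : measurable (~` A) by exact: measurableC.
have mf n : measurable_fun setT (fdd K (nseq n (~` A))).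
  by apply: measurable_fdd => i; rewrite size_nseq nth_nseq => ->.
elim: N x => [|N IH] x /=; first by rewrite add0e KopE_cst.
rewrite /KopE -ge0_integralD//; last 4 first.
- by move=> y _; rewrite adde_ge0 ?mule_ge0 ?hit_ge0// lee_fin.
- apply: emeasurable_funD; first exact: measurable_indicE.
  by apply: emeasurable_funM; [exact: measurable_indicE|exact: measurable_hit].
- move=> y _; rewrite mule_ge0 ?lee_fin//.
  by apply: integral_ge0 => z _; exact: fdd_ge0.
- apply: emeasurable_funM; first exact: measurable_indicE.
  by apply: measurable_KopE => //; exact: fdd_ge0.
rewrite -[RHS](KopE_cst K 1 x) /KopE; apply: eq_integral => y _.
rewrite -addeA -ge0_muleDr ?hit_ge0//; last first.
  by apply: integral_ge0 => z _; exact: fdd_ge0.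
rewrite [X in (_ * X)%E](IH y) mule1 -EFinD; congr (_%:E).
by rewrite !indicE in_setC; case: (y \in A); rewrite /= ?addr0 ?add0r.
Qed.

Lemma hit_le1 A N x : measurable A -> (hit K A N x <= 1)%E.
Proof.
move=> mA; rewrite -(hit_fdd N x mA) leeDl//.
by apply: KopE_ge0 => y; exact: fdd_ge0.
Qed.

Lemma Lret_lim A x : measurable A -> Lret K A x = limn (fun N => hit K A N x).
Proof.
move=> mA; apply/esym/cvg_lim => //.
by apply: ereal_nondecreasing_cvgn; exact: nondecreasing_hit.
Qed.

(** Let B be the event of never being in [A]. It lies in the cylinder that leaves time 0 free and
    avoids [A] at times 1 to N, whence P(B) + E[hit_N(X_0)] <= 1. As N grows the second term tends
    to E[L(X_0)] = 1, whatever the initial law, so P(B) = 0. *)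
Lemma markov_chain_hits {dO} {O : measurableType dO} (P : probability O R)
    (X : nat -> O -> E) A :
  markov_chain P X K -> measurable A -> (forall x, (1 <= Lret K A x)%E) ->
  {ae P, forall w, exists k, A (X k w)}.
Proof.
move=> [mX HX] mA L1; have mAC : measurable (~` A) by exact: measurableC.
have mhitX N : measurable_fun setT (fun w => hit K A N (X 0%N w)).
  by apply: measurableT_comp (mX 0%N); exact: measurable_hit.
have mf n : measurable_fun setT (fdd K (nseq n (~` A))).
  by apply: measurable_fdd => i; rewrite size_nseq nth_nseq => ->.
have mXA k : measurable (X k @^-1` A).
  by rewrite -[X in measurable X]setTI; exact: mX.
pose B := \bigcap_k (X k @^-1` (~` A)).
have mB : measurable B.
  by apply: bigcapT_measurable => k; rewrite -[X in measurable X]setTI; exact: mX.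
have PB N : (P B + \int[P]_w hit K A N (X 0%N w) <= 1)%E.
  have -> : 1%E = (P [set w | forall i, (i < size (setT :: nseq N (~` A)))%N ->
      nth set0 (setT :: nseq N (~` A)) i (X i w)]
      + \int[P]_w hit K A N (X 0%N w))%E.
    rewrite HX; last first.
      move=> [|i] //=; rewrite ltnS size_nseq nth_nseq => ->//.
    rewrite addeC -ge0_integralD//; last 3 first.
    - by move=> w _; exact: hit_ge0.
    - by move=> w _; exact: fdd_ge0.
    - apply: measurableT_comp (mX 0%N); apply: measurable_fdd => -[|i] //=.
      by rewrite ltnS size_nseq nth_nseq => ->.
    rewrite -[LHS](@probability_setT _ _ _ P) -[LHS]mul1e -integral_cst//.
    apply: eq_integral => w _ /=; rewrite indicT mul1e.
    by rewrite [RHS](hit_fdd N (X 0%N w) mA).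
  rewrite leeD2r//; apply: le_measure; rewrite ?inE//.
  - have -> : [set w | forall i, (i < size (setT :: nseq N (~` A)))%N ->
        nth set0 (setT :: nseq N (~` A)) i (X i w)] =
        \bigcap_(i in [set i | (i < size (setT :: nseq N (~` A)))%N])
          (X i @^-1` nth set0 (setT :: nseq N (~` A)) i).
      by apply/seteqP; split.
    apply: bigcap_measurableType => -[|i] /=; first by rewrite preimage_setT.
    rewrite ltnS size_nseq nth_nseq => ->.
    by rewrite -[X in measurable X]setTI; exact: mX.
  - move=> w Bw [|i] //=; rewrite ltnS size_nseq nth_nseq => ->.
    exact: Bw.
have PB1 : (P B + 1 <= 1)%E.
  have -> : (P B + 1)%E = limn (fun N => P B + \int[P]_w hit K A N (X 0%N w))%E.
    rewrite limeD//; last 3 first.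
    - exact: is_cvg_cst.
    - apply: ereal_nondecreasing_is_cvgn => m n mn; apply: ge0_le_integral => //.
      + by move=> w _; exact: hit_ge0.
      + by move=> w _; exact: nondecreasing_hit.
    - by rewrite lim_cst//; apply: fin_num_adde_defr; exact: fin_num_measure.
    rewrite lim_cst//; congr (_ + _)%E; rewrite -monotone_convergence//; last 2 first.
    - by move=> n w _; exact: hit_ge0.
    - by move=> w _; exact: nondecreasing_hit.
    rewrite -[LHS](@probability_setT _ _ _ P) -[LHS]mul1e -integral_cst//.
    apply: eq_integral => w _; rewrite -Lret_lim//.
    apply/eqP; rewrite eq_le L1/=; apply: ge_ereal_sup => _ [N _ <-].
    exact: hit_le1.
  apply: lime_le; last exact: nearW.
  apply: ereal_nondecreasing_is_cvgn => m n mn; rewrite leeD2l//.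
  apply: ge0_le_integral => //.
  + by move=> w _; exact: hit_ge0.
  + by move=> w _; exact: nondecreasing_hit.
exists B; split => //; last first.
  by move=> w /= /forallNP H k _; exact: H.
apply/eqP; rewrite eq_le measure_ge0 andbT.
by rewrite -(@leeD2rE _ 1%E)// add0e.
Qed.

(** Harris recurrence speaks of sets charged by the irreducibility measure phi, while [A] is only
    known to be full for mu. If phi charged the complement, that complement would be reached with
    positive probability from everywhere; but by invariance a mu-null set is hit with probability 0
    from mu-almost every point, which contradicts mu(setT) > 0. So phi(A) > 0 and Q(., A) = 1. The
    term m = 0 of the infimum [Qinf] is L itself, hence L >= 1. *)
Lemma harris_full_Lret (mu : {measure set E -> \bar R}) A :
  harris_recurrent K -> (forall B, measurable B -> (\int[mu]_x K x B = mu B)%E) ->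
  (0 < mu setT)%E -> measurable A -> mu (~` A) = 0%E ->
  forall x, (1 <= Lret K A x)%E.
Proof.
move=> [phi [[phi0 irr] rec]] Kmu mu0 mA muA x.
have mAC : measurable (~` A) by exact: measurableC.
have hit0 N : (\int[mu]_x hit K (~` A) N x = 0)%E.
  elim: N => [|N IH] /=; first by rewrite integral0.
  apply/eqP; rewrite eq_le; apply/andP; split; last first.
    by apply: integral_ge0 => y _; exact: (hit_ge0 _ N.+1).
  have m1 := measurable_indicE mAC.
  have m2 := measurable_hit N mAC.
  have m3 : measurable_fun setT (fun y => (\1_(~` A) y)%:E + hit K (~` A) N y)%E.
    exact: emeasurable_funD.
  have g3 y : (0 <= (\1_(~` A) y)%:E + hit K (~` A) N y)%E.
    by rewrite adde_ge0 ?hit_ge0// lee_fin.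
  apply: (@le_trans _ _ (\int[mu]_x KopE K
      (fun y => (\1_(~` A) y)%:E + hit K (~` A) N y) x)%E).
    apply: ge0_le_integral => //.
    - by move=> y _; exact: (hit_ge0 _ N.+1).
    - exact: (measurable_hit N.+1 mAC).
    - exact: measurable_KopE.
    move=> y _; apply: (le_KopE K
      (h1 := fun z => ((\1_(~` A) z)%:E + (\1_(~` (~` A)) z)%:E * hit K (~` A) N z)%E)) => //.
    + by move=> z; rewrite adde_ge0 ?mule_ge0 ?hit_ge0// lee_fin.
    + apply: emeasurable_funD => //; apply: emeasurable_funM => //.
      by rewrite setCK; exact: measurable_indicE.
    + move=> z; rewrite leeD2l// -[leRHS]mul1e lee_wpmul2r ?hit_ge0//.
      by rewrite lee_fin indicE lern1 leq_b1.
  rewrite integral_KopE// ge0_integralD//.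
    by rewrite IH adde0 integral_indic// setIT muA.
  by move=> y _; exact: hit_ge0.
have phiA : (0 < phi A)%E.
  have phiAC : phi (~` A) = 0%E.
    apply/eqP; rewrite eq_le measure_ge0 andbT leNgt; apply/negP => pA.
    have LA := irr _ mAC pA.
    have : (\int[mu]_x Lret K (~` A) x = 0)%E.
      under eq_integral do rewrite Lret_lim//.
      rewrite monotone_convergence//.
      + by under eq_fun do rewrite hit0; rewrite lim_cst.
      + by move=> n; exact: measurable_hit.
      + by move=> n y _; exact: hit_ge0.
      + by move=> y _; exact: nondecreasing_hit.
    have mL : measurable_fun setT (Lret K (~` A)).
      rewrite (_ : Lret K (~` A) = fun y => limn (fun N => hit K (~` A) N y)).
        apply: (emeasurable_fun_cvg (fun N => hit K (~` A) N)).
          by move=> N; exact: measurable_hit.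
        by move=> y _; apply: ereal_nondecreasing_is_cvgn; exact: nondecreasing_hit.
      by apply/funext => y; rewrite Lret_lim.
    under eq_integral do rewrite -[Lret _ _ _]gee0_abs ?(ltW (LA _))//.
    move/ae_eq_integral_abs => /(_ measurableT mL) [N [mN muN HN]].
    move: mu0; rewrite ltNge => /negP; apply; rewrite -muN le_measure ?inE//.
    move=> y _; apply: HN => /= /(_ Logic.I) L0.
    by move: (LA y); rewrite L0 ltxx.
  move: phi0; rewrite -(setvU A) measureU//; last by rewrite setICl.
  by rewrite [X in (X + _)%E]phiAC add0e.
rewrite -(rec A mA phiA x); apply: ereal_inf_lbound.
by exists 0%N.
Qed.

End recurrence.

(** * Functions controlled by a Lyapunov function *)

Section lyapunov.
Context {R : realType} {d : nat}.
Notation E := (Rd R d).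
Variable K : R.-pker E ~> E.
Variables (U : E -> \bar R) (c : R).
Hypothesis mU : measurable_fun setT U.
Hypothesis U1 : forall x, (1 <= U x)%E.
Hypothesis c0 : 0 < c.
Hypothesis KU : forall x, (KopE K U x <= c%:E * U x)%E.
Implicit Types h a : E -> R.

(** The constant is strictly positive so that C * U = +oo wherever U = +oo: with C = 0 the
    convention 0 * oo = 0 would constrain [h] there. Points with U = +oo thus impose nothing, and
    default values of [Kop] at them do no harm. *)
Definition dom h := measurable_fun setT h /\
  exists2 C : R, 0 < C & forall x, (`|h x|%:E <= C%:E * U x)%E.
Definition dom2 h := measurable_fun setT h /\ dom (fun x => h x ^+ 2).

Let U0 x : (0 <= U x)%E. Proof. by rewrite (le_trans _ (U1 x)). Qed.

Lemma domD h1 h2 : dom h1 -> dom h2 -> dom (fun x => h1 x + h2 x).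
Proof.
move=> [m1 [C1 C10 H1]] [m2 [C2 C20 H2]]; split; first exact: measurable_funD.
exists (C1 + C2); first exact: addr_gt0.
move=> x; rewrite EFinD ge0_muleDl ?lee_fin ?(ltW C10) ?(ltW C20)//.
by apply: le_trans (leeD (H1 x) (H2 x)); rewrite -EFinD lee_fin ler_normD.
Qed.

Lemma domZ r h : dom h -> dom (fun x => r * h x).
Proof.
move=> [m [C C0 H]]; split; first exact: measurable_funM.
exists ((`|r| + 1) * C); first by rewrite mulr_gt0// ltr_pwDr.
move=> x; rewrite normrM EFinM EFinM -muleA.
by apply: lee_pmul => //; rewrite lee_fin// lerDl.
Qed.

Lemma dom_le h1 h2 : measurable_fun setT h1 ->
  (forall x, `|h1 x| <= `|h2 x|) -> dom h2 -> dom h1.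
Proof.
move=> m1 h12 [m2 [C C0 H]]; split => //; exists C => // x.
by apply: le_trans (H x); rewrite lee_fin.
Qed.

Lemma dom_cst r : dom (fun _ => r).
Proof.
split; first exact: measurable_cst.
exists (`|r| + 1); first by rewrite ltr_pwDr.
move=> x; rewrite -[leLHS]mule1; apply: lee_pmul => //.
by rewrite lee_fin lerDl.
Qed.

Lemma dom2_cst r : dom2 (fun _ => r).
Proof. by split; [exact: measurable_cst|exact: dom_cst]. Qed.

Lemma dom2M h1 h2 : dom2 h1 -> dom2 h2 -> dom (fun x => h1 x * h2 x).
Proof.
move=> [m1 d1] [m2 d2]; apply: (dom_le _ _ (domD d1 d2)).
  exact: measurable_funM.
move=> x; rewrite [leRHS]ger0_norm ?addr_ge0 ?sqr_ge0// ler_norml.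
have := sqr_ge0 (h1 x); have := sqr_ge0 (h2 x).
have := sqr_ge0 (h1 x + h2 x); have := sqr_ge0 (h1 x - h2 x).
by rewrite !sqrrD sqrrN mulrN => *; apply/andP; split; lra.
Qed.

Lemma dom2W h : dom2 h -> dom h.
Proof.
move=> d2; have := dom2M (dom2_cst 1) d2.
by under eq_fun do rewrite mul1r.
Qed.

Lemma dom2Z r h : dom2 h -> dom2 (fun x => r * h x).
Proof.
move=> [m dh]; split; first exact: measurable_funM.
by under eq_fun do rewrite exprMn; exact: domZ.
Qed.

Lemma dom2D h1 h2 : dom2 h1 -> dom2 h2 -> dom2 (fun x => h1 x + h2 x).
Proof.
move=> d1 d2; split; first by apply: measurable_funD; [case: d1|case: d2].
have -> : (fun x => (h1 x + h2 x) ^+ 2) =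
    (fun x => (h1 x ^+ 2 + 2 * (h1 x * h2 x)) + h2 x ^+ 2).
  by apply/funext => x; ring.
apply: domD; last by case: d2.
by apply: domD; [case: d1|apply: domZ; exact: dom2M].
Qed.

Lemma dom2_norm h : dom2 h -> dom2 (fun x => `|h x|).
Proof.
move=> [m dh]; split; first exact: measurableT_comp.
by under eq_fun do rewrite real_normK ?num_real//.
Qed.

Lemma dom_sum n (h : nat -> E -> R) : (forall i, dom (h i)) ->
  dom (fun x => \sum_(i < n) h i x).
Proof.
move=> dh; elim: n => [|n IH].
  by under eq_fun do rewrite big_ord0; exact: dom_cst.
by under eq_fun do rewrite big_ord_recr; exact: domD.
Qed.

Lemma dom2_sum n (h : nat -> E -> R) : (forall i, dom2 (h i)) ->
  dom2 (fun x => \sum_(i < n) h i x).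
Proof.
move=> dh; elim: n => [|n IH].
  by under eq_fun do rewrite big_ord0; exact: dom2_cst.
by under eq_fun do rewrite big_ord_recr; exact: dom2D.
Qed.

Lemma dom_integrable {dT} {T : measurableType dT}
    (nu : {measure set T -> \bar R}) (D : set T) (Y : T -> E) h :
  measurable D -> measurable_fun setT Y ->
  (\int[nu]_(w in D) U (Y w) < +oo)%E -> dom h ->
  nu.-integrable D (fun w => (h (Y w))%:E).
Proof.
move=> mD mY UY [mh [C C0 H]].
have mUY : measurable_fun D (fun w => U (Y w)).
  by apply: measurable_funTS; exact: measurableT_comp.
have intU : nu.-integrable D (fun w => C%:E * U (Y w))%E.
  apply: integrableZl => //; apply/integrableP; split => //.
  by under eq_integral do rewrite gee0_abs//.
apply: (le_integrable mD _ _ intU).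
  apply/measurable_EFinP; apply: measurable_funTS; exact: measurableT_comp.
by move=> w _; rewrite [leRHS]gee0_abs ?mule_ge0 ?lee_fin ?(ltW C0)//; exact: H.
Qed.

Lemma dom_integrable_kernel h x : (U x < +oo)%E -> dom h ->
  (K x).-integrable setT (EFin \o h).
Proof.
move=> Ux dh; apply: (dom_integrable (Y := id)) dh => //.
apply: le_lt_trans (KU x) _; rewrite lte_mul_pinfty// lee_fin ltW//.
Qed.

Lemma measurable_Kop h : measurable_fun setT h -> measurable_fun setT (Kop K h).
Proof.
move=> mh; rewrite /Kop /Rintegral.
have -> : (fun x => fine (\int[K x]_y (h y)%:E)) =
    fine \o (fun x => KopE K (EFin \o h)^\+ x - KopE K (EFin \o h)^\- x)%E.
  by apply/funext => x /=; rewrite [in LHS]integralE.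
have mE : measurable_fun setT (EFin \o h) by exact/measurable_EFinP.
apply: measurableT_comp => //; apply: emeasurable_funB; apply: measurable_KopE => //.
- exact: measurable_funepos.
- exact: measurable_funeneg.
Qed.

Lemma dom_Kop h : dom h -> dom (Kop K h).
Proof.
move=> dh; have [mh [C C0 H]] := dh; split; first exact: measurable_Kop.
exists (C * c); first exact: mulr_gt0.
move=> x; have [Ux|] := ltP (U x) +oo%E; last first.
  by rewrite leye_eq => /eqP ->; rewrite gt0_muley ?leey// lte_fin mulr_gt0.
rewrite /Kop (EFin_normr_Rintegral measurableT (dom_integrable_kernel Ux dh)).
have mE : measurable_fun setT (EFin \o h) by exact/measurable_EFinP.
apply: le_trans (le_abse_integral _ measurableT mE) _.
apply: (@le_trans _ _ (\int[K x]_y (C%:E * U y))%E).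
  by apply: ge0_le_integral => //; [exact: measurableT_comp
    |exact: measurable_funeM|move=> y _; exact: H].
rewrite ge0_integralZl ?lee_fin ?(ltW C0)// EFinM -muleA.
rewrite lee_wpmul2l ?lee_fin ?(ltW C0)//.
exact: KU.
Qed.

Lemma KopD h1 h2 x : dom h1 -> dom h2 -> (U x < +oo)%E ->
  Kop K (fun y => h1 y + h2 y) x = Kop K h1 x + Kop K h2 x.
Proof. by move=> d1 d2 Ux; rewrite /Kop RintegralD//; exact: dom_integrable_kernel. Qed.

Lemma KopZ r h x : dom h -> (U x < +oo)%E ->
  Kop K (fun y => r * h y) x = r * Kop K h x.
Proof. by move=> dh Ux; rewrite /Kop RintegralZl//; exact: dom_integrable_kernel. Qed.

Lemma Kop_cst r x : Kop K (fun _ => r) x = r.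
Proof. by rewrite /Kop Rintegral_cst// prob_kernel mulr1. Qed.

(** The comparison is required only where U is finite: since the integral of U under K x is at most
    c * U x < oo, almost every y for K x is such a point. *)
Lemma Kop_le h1 h2 x : dom h1 -> dom h2 -> (U x < +oo)%E ->
  (forall y, (U y < +oo)%E -> h1 y <= h2 y) -> Kop K h1 x <= Kop K h2 x.
Proof.
move=> d1 d2 Ux h12.
have i1 := dom_integrable_kernel Ux d1; have i2 := dom_integrable_kernel Ux d2.
(* Monotonicity of the integral asks for a pointwise inequality, so h2 is replaced by max(h1, h2),
   which equals h2 almost everywhere for K x and dominates h1 everywhere. *)
have dh3 : dom (fun y => Num.max (h1 y) (h2 y)).
  apply: (dom_le (h2 := fun y => `|h1 y| + `|h2 y|)).
  - by apply: measurable_maxr; [case: d1|case: d2].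
  - move=> y; rewrite [leRHS]ger0_norm ?addr_ge0//.
    by case: (leP (h1 y) (h2 y)) => _; rewrite ?lerDl ?lerDr.
  - by apply: domD; [apply: (dom_le _ _ d1)|apply: (dom_le _ _ d2)];
      do ?[by move=> y; rewrite normr_id]; apply: measurableT_comp => //;
      [case: d1|case: d2].
have i3 := dom_integrable_kernel Ux dh3.
have -> : Kop K h2 x = Kop K (fun y => Num.max (h1 y) (h2 y)) x.
  rewrite /Kop /Rintegral; congr fine; apply: ae_eq_integral => //.
  - exact: measurable_int i2.
  - exact: measurable_int i3.
  have KUx : (K x).-integrable setT U.
    apply/integrableP; split => //; under eq_integral do rewrite gee0_abs//.
    apply: le_lt_trans (KU x) _; rewrite lte_mul_pinfty// lee_fin ltW//.
  apply: filterS (integrable_ae measurableT KUx) => y /(_ Logic.I) Uy _.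
  by congr EFin; rewrite max_r// h12// -ge0_fin_numE.
by apply: le_Rintegral => // y _; rewrite le_max lexx.
Qed.

(* Jensen: integrate [h ^+ 2 >= 2 * r * h - r ^+ 2] with [r = Kop K h x] *)
Lemma Kop_sqr_le h x : dom2 h -> (U x < +oo)%E ->
  Kop K h x ^+ 2 <= Kop K (fun y => h y ^+ 2) x.
Proof.
move=> dh Ux; set r := Kop K h x; have dh1 := dom2W dh; have [_ dhh] := dh.
have := @Kop_le (fun y => 2 * r * h y + (- r ^+ 2)) (fun y => h y ^+ 2) x.
rewrite KopD//; [|exact: domZ|exact: dom_cst].
rewrite KopZ// Kop_cst -/r => H.
have -> : r ^+ 2 = 2 * r * r - r ^+ 2 by ring.
apply: H => //; first by apply: domD; [exact: domZ|exact: dom_cst].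
by move=> y _; have := sqr_ge0 (h y - r); rewrite sqrrB; lra.
Qed.

Lemma dom2_Kop h : dom2 h -> dom2 (Kop K h).
Proof.
move=> dh; have [mh dhh] := dh; split; first exact: measurable_Kop.
have [mK [C C0 H]] := dom_Kop dhh.
split; first by apply: measurable_funX; exact: measurable_Kop.
exists C => // x; have [Ux|] := ltP (U x) +oo%E; last first.
  by rewrite leye_eq => /eqP ->; rewrite gt0_muley ?leey.
apply: le_trans (H x); rewrite lee_fin ger0_norm ?sqr_ge0//.
exact: le_trans (Kop_sqr_le dh Ux) (ler_norm _).
Qed.

Lemma dom_iter_Kop k h : dom h -> dom (iter k (Kop K) h).
Proof. by move=> dh; elim: k => //= k; exact: dom_Kop. Qed.

Lemma dom2_iter_Kop k h : dom2 h -> dom2 (iter k (Kop K) h).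
Proof. by move=> dh; elim: k => //= k; exact: dom2_Kop. Qed.

Lemma Kop_sum n (h : nat -> E -> R) x : (forall i, dom (h i)) ->
  (U x < +oo)%E ->
  Kop K (fun y => \sum_(i < n) h i y) x = \sum_(i < n) Kop K (h i) x.
Proof.
move=> dh Ux; elim: n => [|n IH].
  rewrite big_ord0; under [X in Kop K X]eq_fun do rewrite big_ord0.
  exact: Kop_cst.
rewrite big_ord_recr/=; under [X in Kop K X]eq_fun do rewrite big_ord_recr/=.
by rewrite KopD ?IH//; exact: dom_sum.
Qed.

Lemma KopE_Kop h x : dom h -> (U x < +oo)%E ->
  [/\ (KopE K (EFin \o h)^\+ x)%E \is a fin_num,
      (KopE K (EFin \o h)^\- x)%E \is a fin_num &
      (Kop K h x)%:E = (KopE K (EFin \o h)^\+ x - KopE K (EFin \o h)^\- x)%E].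
Proof.
move=> dh Ux; have i := dom_integrable_kernel Ux dh; split.
- exact: integrable_pos_fin_num.
- exact: integrable_neg_fin_num.
by rewrite /Kop /Rintegral fineK ?integrable_fin_num// [in LHS]integralE.
Qed.

(** This carries a one-step identity from nonnegative to signed functions. As the weight [a] is
    nonnegative, the positive and negative parts of a * h are a times those of h. The processes are
    abstract so that the same argument serves an invariant measure (both equal to the identity), one
    step of a chain, and one step weighted by the initial state. *)
Lemma Rintegral_Kop_weighted {dT} {T : measurableType dT}
    (nu : {measure set T -> \bar R}) (D : set T) (Y Y' : T -> E)
    (a : T -> R) h :
  measurable D -> measurable_fun setT Y -> measurable_fun setT Y' ->
  measurable_fun setT a -> (forall w, 0 <= a w) ->
  (forall u, (forall x, (0 <= u x)%E) -> measurable_fun setT u ->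
    \int[nu]_(w in D) ((a w)%:E * u (Y' w)) =
    \int[nu]_(w in D) ((a w)%:E * KopE K u (Y w)))%E ->
  (\int[nu]_(w in D) U (Y w) < +oo)%E ->
  dom h -> nu.-integrable D (fun w => (a w * h (Y' w))%:E) ->
  (\int[nu]_(w in D) (a w * h (Y' w)) =
   \int[nu]_(w in D) (a w * Kop K h (Y w)))%R.
Proof.
move=> mD mY mY' ma a0 step UY dh inth; have [mh _] := dh.
have mE : measurable_fun setT (EFin \o h) by exact/measurable_EFinP.
have mp := measurable_funepos mE; have mn := measurable_funeneg mE.
have p0 := funepos_ge0 (EFin \o h); have n0 := funeneg_ge0 (EFin \o h).
have posE w : ((fun w => (a w * h (Y' w))%:E)^\+ w =
    (a w)%:E * (EFin \o h)^\+ (Y' w))%E.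
  by rewrite !funeposE /= -!EFin_max -EFinM maxr_pMr// mulr0.
have negE w : ((fun w => (a w * h (Y' w))%:E)^\- w =
    (a w)%:E * (EFin \o h)^\- (Y' w))%E.
  by rewrite !funenegE [(EFin \o h) _]/= EFinM -muleN maxe_pMr ?lee_fin// mule0.
have mKp : measurable_fun D (fun w => (a w)%:E * KopE K (EFin \o h)^\+ (Y w))%E.
  apply: measurable_funTS; apply: emeasurable_funM; first exact/measurable_EFinP.
  by apply: measurableT_comp mY; exact: measurable_KopE.
have mKn : measurable_fun D (fun w => (a w)%:E * KopE K (EFin \o h)^\- (Y w))%E.
  apply: measurable_funTS; apply: emeasurable_funM; first exact/measurable_EFinP.
  by apply: measurableT_comp mY; exact: measurable_KopE.
have Kp0 w : (0 <= (a w)%:E * KopE K (EFin \o h)^\+ (Y w))%E.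
  by rewrite mule_ge0 ?lee_fin//; exact: KopE_ge0.
have Kn0 w : (0 <= (a w)%:E * KopE K (EFin \o h)^\- (Y w))%E.
  by rewrite mule_ge0 ?lee_fin//; exact: KopE_ge0.
rewrite /Rintegral integralE; congr fine.
have ip := integral_funepos_lt_pinfty mD inth.
have in_ := integral_funeneg_lt_pinfty mD inth.
have ipE : (\int[nu]_(w in D) (fun w => (a w * h (Y' w))%:E)^\+ w =
    \int[nu]_(w in D) ((a w)%:E * KopE K (EFin \o h)^\+ (Y w)))%E.
  by rewrite -step//; apply: eq_integral => w _; exact: posE.
have inE_ : (\int[nu]_(w in D) (fun w => (a w * h (Y' w))%:E)^\- w =
    \int[nu]_(w in D) ((a w)%:E * KopE K (EFin \o h)^\- (Y w)))%E.
  by rewrite -step//; apply: eq_integral => w _; exact: negE.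
rewrite ipE in ip *; rewrite inE_ in in_ *.
rewrite -integralB//; last 2 first.
- by apply/integrableP; split => //; under eq_integral do rewrite gee0_abs//.
- by apply/integrableP; split => //; under eq_integral do rewrite gee0_abs//.
apply: ae_eq_integral => //.
- exact: emeasurable_funB.
- apply/measurable_EFinP; apply: measurable_funTS; apply: measurable_funM => //.
  by apply: measurableT_comp mY; exact: measurable_Kop.
(* The difference of the two extended integrals agrees with [Kop] only where both are finite.
   Integrability of U along Y gives this almost everywhere. *)
have intU : nu.-integrable D (fun w => U (Y w)).
  apply/integrableP; split; last by under eq_integral do rewrite gee0_abs//.
  by apply: measurable_funTS; exact: measurableT_comp.
apply: filterS (integrable_ae mD intU) => w /[apply] Uw.
have {}Uw : (U (Y w) < +oo)%E by rewrite -ge0_fin_numE.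
have := KopE_Kop dh Uw.
move: (KopE K (EFin \o h)^\+ (Y w))%E (KopE K (EFin \o h)^\- (Y w))%E => u v.
move=> [/fineK <- /fineK <-]; rewrite -EFinB => -[->].
by rewrite -!EFinM -EFinB mulrBr.
Qed.


Lemma Rintegral_Kop_step {dT} {T : measurableType dT}
    (nu : {measure set T -> \bar R}) (D : set T) (Y Y' : T -> E) h :
  measurable D -> measurable_fun setT Y -> measurable_fun setT Y' ->
  (forall u, (forall x, (0 <= u x)%E) -> measurable_fun setT u ->
    \int[nu]_(w in D) u (Y' w) = \int[nu]_(w in D) KopE K u (Y w))%E ->
  (\int[nu]_(w in D) U (Y w) < +oo)%E ->
  dom h -> nu.-integrable D (fun w => (h (Y' w))%:E) ->
  (\int[nu]_(w in D) h (Y' w) = \int[nu]_(w in D) Kop K h (Y w))%R.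
Proof.
move=> mD mY mY' step UY dh inth.
transitivity (\int[nu]_(w in D) (1 * h (Y' w)))%R.
  by apply: eq_Rintegral => w _; rewrite mul1r.
rewrite (@Rintegral_Kop_weighted _ _ nu D Y Y' (cst 1) h)//.
- by apply: eq_Rintegral => w _; rewrite mul1r.
- move=> u u0 mu_; under eq_integral do rewrite mul1e.
  by under [RHS]eq_integral do rewrite mul1e; exact: step.
- by under eq_fun do rewrite mul1r.
Qed.

Lemma Kop_eq h1 h2 x : dom h1 -> dom h2 -> (U x < +oo)%E ->
  (forall y, (U y < +oo)%E -> h1 y = h2 y) -> Kop K h1 x = Kop K h2 x.
Proof.
move=> d1 d2 Ux h12; apply/eqP; rewrite eq_le.
by apply/andP; split; apply: Kop_le => // y Uy; rewrite h12.
Qed.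

(* [lagsum g N x] and [sqsum g N x] are the first two moments of
   [g(X_0) + ... + g(X_(N-1))] for the chain started at [x]. *)
Definition lagsum (g : E -> R) N x := \sum_(k < N) iter k (Kop K) g x.
(** For the chain started at x, this is the mean of (g(X_0) + ... + g(X_N))^2 minus (g(X_1) + ... +
    g(X_N))^2: the square of the first term and its cross terms with the later ones. *)
Definition sqincr (g : E -> R) N x :=
  g x ^+ 2 + 2 * (g x * \sum_(k < N) iter k.+1 (Kop K) g x).
Fixpoint sqsum (g : E -> R) N : E -> R :=
  if N is N'.+1 then fun x => sqincr g N' x + Kop K (sqsum g N') x
  else fun=> 0.

Lemma dom_sqincr g N : dom2 g -> dom (sqincr g N).
Proof.
move=> dg; apply: domD; first by case: dg.
apply: domZ; apply: dom2M => //.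
apply: (@dom2_sum N (fun k => iter k.+1 (Kop K) g)) => k.
exact: (dom2_iter_Kop k.+1).
Qed.

Lemma dom_sqsum g N : dom2 g -> dom (sqsum g N).
Proof.
move=> dg; elim: N => [|N IH] /=; first exact: dom_cst.
by apply: domD; [exact: dom_sqincr|exact: dom_Kop].
Qed.

(** Jensen for the law of the path, obtained by induction on N. With m_N and s_N the two moments,
    m_(N+1) = g + K m_N and s_(N+1) = g^2 + 2 g K m_N + K s_N, so it suffices that (K m_N)^2 <= K
    (m_N^2) <= K s_N. Its use is the nonnegativity of [sqsum] where U is finite. *)
Lemma sqr_lagsum_le g N x : dom2 g -> (U x < +oo)%E ->
  lagsum g N x ^+ 2 <= sqsum g N x.
Proof.
move=> dg; elim: N x => [|N IH] x Ux.
  by rewrite /lagsum big_ord0 expr0n.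
have dm : dom2 (lagsum g N).
  by apply: (@dom2_sum N (fun k => iter k (Kop K) g)) => k; exact: dom2_iter_Kop.
rewrite {1}/lagsum big_ord_recl /=.
have -> : \sum_(i < N) iter (bump 0 i) (Kop K) g x = Kop K (lagsum g N) x.
  rewrite (@Kop_sum N (fun k => iter k (Kop K) g))// => k.
  by apply: dom_iter_Kop; exact: dom2W.
have : Kop K (lagsum g N) x ^+ 2 <= Kop K (sqsum g N) x.
  apply: le_trans (Kop_sqr_le dm Ux) _.
  by apply: Kop_le => //; [case: dm|exact: dom_sqsum].
rewrite /sqincr (_ : \sum_(k < N) _ = Kop K (lagsum g N) x); last first.
  rewrite (@Kop_sum N (fun k => iter k (Kop K) g))// => k.
  by apply: dom_iter_Kop; exact: dom2W.
by rewrite sqrrD => ?; lra.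
Qed.

Lemma sqsum_ge0 g N x : dom2 g -> (U x < +oo)%E -> 0 <= sqsum g N x.
Proof. by move=> dg Ux; apply: le_trans (sqr_lagsum_le N dg Ux); exact: sqr_ge0. Qed.

(** * Second moments under an invariant measure *)

Section invariant.
Variable mu : {measure set E -> \bar R}.
Hypothesis Kmu : forall A, measurable A -> (\int[mu]_x K x A = mu A)%E.
Hypothesis muU : (\int[mu]_x U x < +oo)%E.

Lemma dom_integrableT h : dom h -> mu.-integrable setT (EFin \o h).
Proof. exact: (@dom_integrable _ _ mu setT id). Qed.

Lemma Rintegral_Kop h : dom h ->
  Rintegral mu setT (Kop K h) = Rintegral mu setT h.
Proof.
move=> dh; apply/esym; apply: (@Rintegral_Kop_step _ _ mu setT id id) => //.
- by move=> u u0 mu_; rewrite integral_KopE.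
- exact: dom_integrableT.
Qed.

Lemma Rintegral_sqsum g N : dom2 g ->
  Rintegral mu setT (sqsum g N) = \sum_(n < N) Rintegral mu setT (sqincr g n).
Proof.
move=> dg; elim: N => [|N IH]; first by rewrite big_ord0 /sqsum Rintegral_cst// mul0r.
rewrite big_ord_recr/= -IH addrC RintegralD//; last 2 first.
- by apply: dom_integrableT; exact: dom_sqincr.
- by apply: dom_integrableT; apply: dom_Kop; exact: dom_sqsum.
by rewrite Rintegral_Kop//; exact: dom_sqsum.
Qed.

(** For a centered g this is, up to the mass of mu, a partial sum of the two-sided autocovariance
    series. Bounded partial sums therefore make the stationary variance grow at most linearly. *)
Lemma Rintegral_sqincr g N : dom2 g ->
  Rintegral mu setT (sqincr g N) = Rintegral mu setT (fun x => g x ^+ 2) +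
    2 * \sum_(k < N) Rintegral mu setT (fun x => g x * iter k.+1 (Kop K) g x).
Proof.
move=> dg; have dgk k : dom (fun x => g x * iter k.+1 (Kop K) g x).
  by apply: dom2M => //; exact: (dom2_iter_Kop k.+1).
have dS n : dom (fun x => \sum_(k < n) (g x * iter k.+1 (Kop K) g x)).
  exact: (@dom_sum n (fun k x => g x * iter k.+1 (Kop K) g x)).
transitivity (Rintegral mu setT (fun x =>
    g x ^+ 2 + 2 * \sum_(k < N) (g x * iter k.+1 (Kop K) g x))).
  by apply: eq_Rintegral => x _; rewrite -mulr_sumr.
rewrite RintegralD//; last 2 first.
- by apply: dom_integrableT; case: dg.
- by apply: dom_integrableT; exact: domZ.
rewrite RintegralZl//; last exact: dom_integrableT.
congr (_ + 2 * _); elim: N => [|N IH].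
  by under eq_Rintegral do rewrite big_ord0; rewrite big_ord0 Rintegral_cst// mul0r.
under eq_Rintegral do rewrite big_ord_recr.
rewrite RintegralD//; last 2 first.
- by apply: dom_integrableT; exact: dS.
- by apply: dom_integrableT; exact: (dgk N).
by rewrite IH big_ord_recr.
Qed.

End invariant.

(** * Second moments along the chain from a general initial law *)

Section chain.
Context {dO : measure_display} {O : measurableType dO} (P : probability O R).
Variable D : set O.
Implicit Types Y : nat -> O -> E.

Definition dom_start Y := markov_on K P D Y /\ (\int[P]_(w in D) U (Y 0%N w) < +oo)%E.

Lemma dom_start_shift Y : dom_start Y -> dom_start (fun t => Y t.+1).
Proof.
move=> [HDY UY]; have [mD mY _] := HDY; split; first exact: markov_on_shift.
rewrite (integral_markov_step HDY)//.
have mUY : measurable_fun D (fun w => U (Y 0%N w)).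
  by apply: measurable_funTS; exact: (measurable_comp_state 0%N mY).
apply: (@le_lt_trans _ _ (\int[P]_(w in D) (c%:E * U (Y 0%N w)))%E).
  apply: ge0_le_integral => //.
  - by move=> w _; exact: KopE_ge0.
  - apply: measurable_funTS; apply: (measurable_comp_state 0%N mY).
    exact: measurable_KopE.
  - exact: measurable_funeM.
by rewrite ge0_integralZl// ?lee_fin 1?ltW// lte_mul_pinfty// lee_fin ltW.
Qed.

Lemma dom_start_shiftn k Y : dom_start Y -> dom_start (fun t => Y (k + t)%N).
Proof.
elim: k Y => [//|k IH] Y HY.
have := dom_start_shift (IH Y HY).
by rewrite (_ : (fun t => Y (k + t.+1)%N) = (fun t => Y (k.+1 + t)%N))//;
  apply/funext => t; rewrite addnS.
Qed.

Lemma dom_integrable_state Y k h : dom_start Y -> dom h ->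
  P.-integrable D (fun w => (h (Y k w))%:E).
Proof.
move=> HY; have [[mD mY _]] := dom_start_shiftn k HY.
by rewrite addn0 => UY dh; apply: dom_integrable UY dh => //; have := mY 0%N; rewrite addn0.
Qed.

Lemma dom2_integrable_state2 Y i j a h : dom_start Y -> dom2 a -> dom2 h ->
  P.-integrable D (fun w => (a (Y i w) * h (Y j w))%:E).
Proof.
move=> HY da dh; have [[mD mY _] _] := HY.
have i1 := dom_integrable_state i HY da.2; have i2 := dom_integrable_state j HY dh.2.
apply: (le_integrable mD _ _ (integrableD mD i1 i2)).
  apply/measurable_EFinP; apply: measurable_funTS; apply: measurable_funM.
    by apply: measurableT_comp (mY i); case: da.
  by apply: measurableT_comp (mY j); case: dh.
move=> w _ /=; rewrite lee_fin [leRHS]ger0_norm ?addr_ge0 ?sqr_ge0// ler_norml.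
have := sqr_ge0 (a (Y i w)); have := sqr_ge0 (h (Y j w)).
have := sqr_ge0 (a (Y i w) + h (Y j w)); have := sqr_ge0 (a (Y i w) - h (Y j w)).
by rewrite !sqrrD sqrrN mulrN => *; apply/andP; split; lra.
Qed.

Lemma Rintegral_lag Y k a h : dom_start Y -> dom2 a -> dom2 h ->
  (\int[P]_(w in D) (a (Y 0%N w) * h (Y k w)) =
   \int[P]_(w in D) (a (Y 0%N w) * iter k (Kop K) h (Y 0%N w)))%R.
Proof.
move=> HY; have [HM UY] := HY; have [mD mY _] := HM.
(* For nonnegative weights, the last step before time k + 1 is integrated out, which turns u into K
   u at time k; the induction hypothesis then applies to K u. *)
have pos b u : dom2 b -> (forall x, 0 <= b x) -> dom2 u ->
    (\int[P]_(w in D) (b (Y 0%N w) * u (Y k w)) =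
     \int[P]_(w in D) (b (Y 0%N w) * iter k (Kop K) u (Y 0%N w)))%R.
  move=> db b0; have [mb _] := db.
  elim: k u => [//|k IH] u du.
  rewrite iterSr -IH; last exact: dom2_Kop.
  apply: (@Rintegral_Kop_weighted _ _ P D (Y k) (Y k.+1)
    (fun w => b (Y 0%N w))) => //.
  - exact: measurableT_comp.
  - move=> v v0 mv.
    have b0E x : (0 <= (EFin \o b) x)%E by rewrite lee_fin.
    have mEb : measurable_fun setT (EFin \o b) by exact/measurable_EFinP.
    rewrite [LHS](integral_markov_iter2 k.+1 HM b0E mEb v0 mv).
    rewrite [RHS](integral_markov_iter2 k HM b0E mEb (KopE_ge0 K v0)
      (measurable_KopE K v0 mv)).
    by rewrite -iterSr.
  - by have [_] := dom_start_shiftn k HY; rewrite addn0.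
  - exact: dom2W.
  - exact: (dom2_integrable_state2 0%N k.+1 HY db du).
move=> da dh; have dn := dom2_norm da.
(* A signed weight is written as |a| - (|a| - a), a difference of two nonnegative weights that are
   still dominated. *)
have dm : dom2 (fun x => `|a x| - a x).
  by apply: dom2D => //; under eq_fun do rewrite -mulN1r; exact: dom2Z.
have split_ u : P.-integrable D (fun w => (`|a (Y 0%N w)| * u w)%:E) ->
    P.-integrable D (fun w => ((`|a (Y 0%N w)| - a (Y 0%N w)) * u w)%:E) ->
    (\int[P]_(w in D) (a (Y 0%N w) * u w) =
     \int[P]_(w in D) (`|a (Y 0%N w)| * u w) -
     \int[P]_(w in D) ((`|a (Y 0%N w)| - a (Y 0%N w)) * u w))%R.
  move=> i1 i2; rewrite -RintegralB//.
  by apply: eq_Rintegral => w _; rewrite -mulrBl opprB addrCA subrr addr0.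
rewrite !split_; try by [exact: (dom2_integrable_state2 0%N k HY dn dh)
  |exact: (dom2_integrable_state2 0%N k HY dm dh)
  |exact: (dom2_integrable_state2 0%N 0%N HY dn (dom2_iter_Kop k dh))
  |exact: (dom2_integrable_state2 0%N 0%N HY dm (dom2_iter_Kop k dh))].
rewrite (pos _ _ dn)// (pos _ _ dm)//.
by move=> x; rewrite subr_ge0 ler_norm.
Qed.

Lemma integrable_sqr_sum Y g N : dom_start Y -> dom2 g ->
  P.-integrable D (fun w => ((\sum_(t < N) g (Y t w)) ^+ 2)%:E).
Proof.
move=> HY dg; have [[mD mY _] _] := HY.
have mgY t : measurable_fun setT (fun w => g (Y t w)).
  by apply: measurableT_comp (mY t); case: dg.
elim: N => [|N IH].
  under eq_fun do rewrite big_ord0 expr0n.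
  exact: finite_measure_integrable_cst.
have i1 := dom_integrable_state N HY dg.2.
have i2 := integrableZl mD 2 (integrableD mD IH i1).
apply: (le_integrable mD _ _ i2).
  apply/measurable_EFinP; apply: measurable_funTS; apply: measurable_funX.
  exact: measurable_sum.
move=> w _ /=; rewrite lee_fin big_ord_recr/=.
set s := \sum_(i < N) _; set x := g _.
rewrite ger0_norm ?sqr_ge0// ger0_norm; last first.
  by rewrite mulr_ge0// addr_ge0// sqr_ge0.
by have := sqr_ge0 (s - x); rewrite !sqrrD sqrrN mulrN; lra.
Qed.

(** The first term is split off the square. Its cross terms are lagged products; the remaining
    square belongs to the shifted chain, so the induction hypothesis gives [sqsum] at time 1 and one
    Markov step gives its image under K at time 0. Hence the induction is over all processes Y. *)
Lemma Rintegral_sqr_sum Y g N : dom_start Y -> dom2 g ->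
  (\int[P]_(w in D) ((\sum_(t < N) g (Y t w)) ^+ 2) =
   \int[P]_(w in D) sqsum g N (Y 0%N w))%R.
Proof.
move=> + dg; elim: N Y => [|N IH] Y HY.
  by apply: eq_Rintegral => w _; rewrite big_ord0 expr0n.
have [HM UY] := HY; have [mD mY _] := HM.
have HY' := dom_start_shift HY.
have iprod k : P.-integrable D (fun w => (g (Y 0%N w) * g (Y k.+1 w))%:E).
  exact: (dom2_integrable_state2 0%N k.+1 HY dg dg).
have iprodK k : P.-integrable D
    (fun w => (g (Y 0%N w) * iter k.+1 (Kop K) g (Y 0%N w))%:E).
  exact: (dom2_integrable_state2 0%N 0%N HY dg (dom2_iter_Kop k.+1 dg)).
have Rsum n (u : nat -> O -> R) : (forall k, P.-integrable D (EFin \o u k)) ->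
    (\int[P]_(w in D) (\sum_(k < n) u k w) =
     \sum_(k < n) \int[P]_(w in D) u k w)%R /\
    P.-integrable D (fun w => (\sum_(k < n) u k w)%:E).
  move=> iu; elim: n => [|n [IHn IHi]].
    split; last first.
      under eq_fun do rewrite big_ord0.
      exact: finite_measure_integrable_cst.
    by under eq_Rintegral do rewrite big_ord0; rewrite big_ord0 Rintegral_cst// mul0r.
  split.
    under eq_Rintegral do rewrite big_ord_recr/=.
    by rewrite RintegralD// big_ord_recr/= IHn.
  under eq_fun do rewrite big_ord_recr/= EFinD.
  exact: (integrableD mD IHi (iu n)).
have [S1 I1] := Rsum N _ iprod; have [S2 I2] := Rsum N _ iprodK.
have ig2 := dom_integrable_state 0%N HY dg.2.
transitivity (\int[P]_(w in D) (g (Y 0%N w) ^+ 2 +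
    (2 * (\sum_(k < N) g (Y 0%N w) * g (Y k.+1 w)) +
     (\sum_(t < N) g (Y t.+1 w)) ^+ 2)))%R.
  apply: eq_Rintegral => w _; rewrite big_ord_recl -mulr_sumr sqrrD -addrA; congr (_ + _).
  by rewrite mulr2n mulrDl mul1r; congr (_ + _).
transitivity (\int[P]_(w in D) (g (Y 0%N w) ^+ 2 +
    (2 * (\sum_(k < N) g (Y 0%N w) * iter k.+1 (Kop K) g (Y 0%N w)) +
     Kop K (sqsum g N) (Y 0%N w))))%R; last first.
  by apply: eq_Rintegral => w _ /=; rewrite /sqincr -mulr_sumr addrA.
have iS := integrable_sqr_sum N HY' dg.
have iK : P.-integrable D (fun w => (Kop K (sqsum g N) (Y 0%N w))%:E).
  exact: (dom_integrable_state 0%N HY (dom_Kop (dom_sqsum N dg))).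
have i1 := integrableZl mD 2 I1; have i2 := integrableZl mD 2 I2.
rewrite RintegralD//; last exact: (integrableD mD i1 iS).
rewrite [in RHS]RintegralD//; last exact: (integrableD mD i2 iK).
rewrite RintegralD// [in RHS]RintegralD// !RintegralZl// S1 S2.
congr (_ + (2 * _ + _)).
  by apply: eq_bigr => k _; rewrite (Rintegral_lag k.+1 HY dg dg).
rewrite (IH _ HY').
apply: (@Rintegral_Kop_step _ _ P D (Y 0%N) (Y 1%N)) => //.
- by move=> u u0 mu_; exact: integral_markov_step.
- exact: dom_sqsum.
- by apply: (dom_integrable_state 1%N HY); exact: dom_sqsum.
Qed.

End chain.
End lyapunov.

(** * Averages of real sequences *)

Section averages.
Context {R : realType}.
Implicit Type x : nat -> R.

(** Cauchy-Schwarz, read off from the nonnegativity of the sum of (x_t - c)^2 with c the mean of the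
    block. *)
Lemma sqr_sum_le m n x : (m <= n)%N ->
  (\sum_(m <= t < n) x t) ^+ 2 <= (n - m)%:R * \sum_(m <= t < n) x t ^+ 2.
Proof.
rewrite leq_eqVlt => /orP[/eqP ->|mn]; first by rewrite !big_geq// expr0n mulr0.
set s := \sum_(m <= t < n) x t; pose c := s / (n - m)%:R.
have nm0 : 0 < (n - m)%:R :> R by rewrite ltr0n subn_gt0.
have : 0 <= \sum_(m <= t < n) (x t - c) ^+ 2 by apply: sumr_ge0 => t _; exact: sqr_ge0.
have -> : \sum_(m <= t < n) (x t - c) ^+ 2 =
    \sum_(m <= t < n) x t ^+ 2 - 2 * c * s + (n - m)%:R * c ^+ 2.
  have -> : \sum_(m <= t < n) (x t - c) ^+ 2 =
      \sum_(m <= t < n) (x t ^+ 2 + (- (2 * c)) * x t + c ^+ 2).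
    by apply: eq_bigr => t _; ring.
  by rewrite !big_split/= -mulr_sumr sumr_const_nat mulNr -(mulr_natl (c ^+ 2)).
rewrite /c => H; rewrite -subr_ge0.
have -> : (n - m)%:R * \sum_(m <= t < n) x t ^+ 2 - s ^+ 2 =
    (n - m)%:R * (\sum_(m <= t < n) x t ^+ 2 - 2 * (s / (n - m)%:R) * s +
      (n - m)%:R * (s / (n - m)%:R) ^+ 2).
  by field; rewrite gt_eqF.
by rewrite mulr_ge0 // ltW.
Qed.

(* The [n]-th term controls all averages of length in [(n+1)^2, (n+2)^2). *)
Definition sqblock x n : R :=
  n.+1%:R ^- 4 * (\sum_(t < n.+1 ^ 2) x t) ^+ 2 +
  n.+1%:R ^- 3 * \sum_(n.+1 ^ 2 <= t < n.+2 ^ 2) x t ^+ 2.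

Lemma sqr_block N : (0 < N)%N -> exists n, (n.+1 ^ 2 <= N < n.+2 ^ 2)%N.
Proof.
case: N => // N _; elim: N => [|N [n /andP[n1 n2]]]; first by exists 0%N.
have [H|H] := ltnP N.+2 (n.+2 ^ 2); first by exists n; rewrite H ltnW.
by exists n.+1; rewrite H (leq_ltn_trans n2)// ltn_exp2r.
Qed.

(** With a = n + 1, the block has 2n + 3 <= 3a terms, so (s + u)^2 <= 2 s^2 + 2 u^2 <= 2 s^2 + 6 a
    q. Rounding 2 up to 6 gives a common constant, and a^-4 * a = a^-3 explains the second weight in
    [sqblock]. *)
Lemma sqr_average_le x n N : (n.+1 ^ 2 <= N < n.+2 ^ 2)%N ->
  (N%:R^-1 * \sum_(t < N) x t) ^+ 2 <= 6 * sqblock x n.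
Proof.
move=> /andP[n1 n2].
have N0 : (0 < N)%N by apply: leq_trans n1.
rewrite -(big_mkord xpredT x) (big_cat_nat _ n1)//= big_mkord.
set s := \sum_(t < _) x t; set u := \sum_(_ <= t < N) x t.
set q := \sum_(n.+1 ^ 2 <= t < n.+2 ^ 2) x t ^+ 2.
pose a : R := n.+1%:R; have a1 : 1 <= a by rewrite ler1n.
have a0 : 0 < a by exact: lt_le_trans a1.
have q0 : 0 <= q by apply: sumr_ge0 => t _; exact: sqr_ge0.
have uq : u ^+ 2 <= 3 * a * q.
  apply: le_trans (sqr_sum_le _ n1) _; apply: ler_pM => //.
  - by apply: sumr_ge0 => t _; exact: sqr_ge0.
  - rewrite /a -natrM ler_nat leq_subLR (leq_trans (ltnW n2))//.
    by rewrite -!mulnn; lia.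
  - rewrite /q (big_cat_nat n1 (ltnW n2))/= lerDl.
    by apply: sumr_ge0 => t _; exact: sqr_ge0.
have aN : a ^+ 2 <= N%:R by rewrite /a -natrX ler_nat.
have Ninv : (N%:R ^+ 2)^-1 <= a ^- 4.
  rewrite lef_pV2 ?posrE ?exprn_gt0 ?ltr0n//.
  by rewrite (exprM a 2 2) lerXn2r ?nnegrE ?exprn_ge0// ltW.
rewrite exprMn exprVn.
apply: (@le_trans _ _ (a ^- 4 * (2 * s ^+ 2 + 2 * u ^+ 2))).
  apply: ler_pM => //; rewrite ?invr_ge0 ?sqr_ge0//.
  by rewrite -subr_ge0 (_ : _ - _ = (s - u) ^+ 2) ?sqr_ge0//; ring.
apply: (@le_trans _ _ (a ^- 4 * (6 * s ^+ 2 + 6 * (a * q)))).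
  rewrite ler_wpM2l ?invr_ge0 ?exprn_ge0 ?(ltW a0)//.
  have := sqr_ge0 s; move: uq; rewrite -mulrA; move: (a * q) (s ^+ 2) (u ^+ 2) => ? ? ?; lra.
rewrite /sqblock -/a -/s -/q le_eqVlt; apply/orP; left; apply/eqP.
by field; rewrite gt_eqF.
Qed.

Lemma cvg_average0 x : sqblock x n @[n --> \oo] --> 0 ->
  (N%:R^-1 * \sum_(t < N) x t) @[N --> \oo] --> 0.
Proof.
move=> xq; apply/cvgr0Pnorm_lt => e e0.
have e60 : 0 < e ^+ 2 / 6 by rewrite divr_gt0// exprn_gt0.
move/cvgr0Pnorm_lt : xq => /(_ _ e60) [n0 _ Hn0].
exists (n0.+2 ^ 2)%N => // N /= n0N.
have [n /andP[n1 n2]] : exists n, (n.+1 ^ 2 <= N < n.+2 ^ 2)%N.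
  by apply: sqr_block; apply: leq_trans n0N; rewrite expn_gt0.
have n0n : (n0 <= n)%N.
  rewrite leqNgt; apply/negP => nn0; move: (leq_ltn_trans n0N n2).
  by rewrite ltn_exp2r// !ltnS ltnNge (ltnW nn0).
have H := Hn0 n n0n.
have habs (y r : R) : 0 < r -> y ^+ 2 < r ^+ 2 -> `|y| < r.
  by move=> r0 yr; rewrite -ltr_sqr ?nnegrE ?(ltW r0)// real_normK ?num_real.
apply: habs => //.
apply: le_lt_trans (sqr_average_le x (introT andP (conj n1 n2))) _.
by rewrite mulrC -ltr_pdivlMr//; exact: le_lt_trans (ler_norm _) H.
Qed.

Lemma cvg_average_shift k x :
  (N%:R^-1 * \sum_(t < N) x (k + t)%N) @[N --> \oo] --> 0 ->
  (N%:R^-1 * \sum_(t < N) x t) @[N --> \oo] --> 0.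
Proof.
move=> H; rewrite -(cvg_shiftn k); set C := \sum_(t < k) x t.
apply/norm_cvg0P.
apply: (@squeeze_cvgr _ _ _ _ (fun=> 0)
  (fun N => N%:R^-1 * `|C| + `|N%:R^-1 * \sum_(t < N) x (k + t)%N|)).
- exists 1%N => // N /= N0; apply/andP; split => //.
  have -> : \sum_(t < N + k) x t = C + \sum_(t < N) x (k + t)%N.
    by rewrite addnC big_split_ord.
  rewrite mulrDr; apply: le_trans (ler_normD _ _) _.
  have NkN : ((N + k)%:R : R)^-1 <= N%:R^-1.
    by rewrite lef_pV2 ?posrE ?ltr0n ?addn_gt0 ?N0// ler_nat leq_addr.
  by rewrite !normrM !normfV !normr_nat lerD// ler_wpM2r.
- exact: cvg_cst.
- rewrite -[X in _ --> X]addr0; apply: cvgD; last exact/norm_cvg0P.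
  rewrite -[X in _ --> X](mul0r `|C|); apply: cvgMr_tmp => //.
  by rewrite -cvg_shiftS; exact: cvg_harmonic.
Qed.

Lemma nneseries_inv_sqr_lty (C : R) : 0 <= C ->
  (\sum_(n <oo) (C / n.+1%:R ^+ 2)%:E < +oo)%E.
Proof.
move=> C0; apply: (@le_lt_trans _ _ (2 * C)%:E); last exact: ltry.
apply: lime_le.
  by apply: is_cvg_nneseries => n _ _; rewrite lee_fin divr_ge0// exprn_ge0.
apply: nearW => n; rewrite sumEFin lee_fin.
(* A telescoping majorant: C / k^2 <= 2 C (1/k - 1/(k+1)) because k + 1 <= 2k for k >= 1. *)
apply: (@le_trans _ _ (2 * C * (1 - n.+1%:R^-1))); last first.
  by rewrite ler_piMr ?mulr_ge0// lerBlDr lerDl invr_ge0.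
elim: n => [|n IH]; first by rewrite big_geq// invr1 subrr mulr0.
rewrite big_nat_recr//=; apply: le_trans (lerD IH (lexx _)) _.
have a1 : 1 <= n.+1%:R :> R by rewrite ler1n.
rewrite -[n.+2]addn1 natrD; move: (n.+1%:R : R) a1 => a a1.
have a0 : 0 < a by exact: lt_le_trans a1.
rewrite -subr_ge0 (_ : _ - _ = C * (a - 1) / (a ^+ 2 * (a + 1))).
  by rewrite divr_ge0 ?mulr_ge0 ?subr_ge0 ?exprn_ge0 ?addr_ge0// ltW.
by field; rewrite !gt_eqF// addr_gt0.
Qed.

Lemma nneseries_lty_cvg0 (z : nat -> R) : (forall n, 0 <= z n) ->
  (\sum_(n <oo) (z n)%:E < +oo)%E -> z n @[n --> \oo] --> 0.
Proof.
move=> z0 H; apply: cvg_series_cvg_0; apply: nondecreasing_is_cvgn.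
  apply/nondecreasing_seqP => n; rewrite /series/= big_nat_recr//= lerDl//.
have S0 : (0 <= \sum_(n <oo) (z n)%:E)%E by apply: nneseries_ge0 => n _ _; rewrite lee_fin.
exists (fine (\sum_(n <oo) (z n)%:E)%E) => _ [n _ <-].
rewrite -lee_fin fineK ?ge0_fin_numE// /series/= -sumEFin.
by apply: nneseries_lim_ge => k _ _; rewrite lee_fin.
Qed.

End averages.

(** * Strong law for Harris chains *)

Section lyapunov_series.
Context {R : realType} {d : nat}.
Notation E := (Rd R d).
Variable K : R.-pker E ~> E.
Variable b : E -> \bar R.
Hypotheses (mb : measurable_fun setT b) (b1 : forall x, (1 <= b x)%E).

Let b0 x : (0 <= b x)%E. Proof. exact: le_trans (b1 x). Qed.

(** The resolvent of K with discount 1/2, applied to b. Applying K shifts the series by one index,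
    that is, doubles it and drops its first term, whence K U <= 2 U. Against an invariant measure
    the weights sum to 2, so integrability of b is inherited. *)
Definition lyap x : \bar R :=
  (\sum_(t <oo) ((2^-1 ^+ t)%:E * iter t (KopE K) b x))%E.

Let term0 t x : (0 <= (2^-1 ^+ t)%:E * iter t (KopE K) b x)%E.
Proof. by rewrite mule_ge0// ?lee_fin ?exprn_ge0//; exact: iter_KopE_ge0. Qed.

Let mterm t : measurable_fun setT (fun x => (2^-1 ^+ t)%:E * iter t (KopE K) b x)%E.
Proof. by apply: measurable_funeM; exact: measurable_iter_KopE. Qed.

Lemma measurable_lyap : measurable_fun setT lyap.
Proof. exact: ge0_emeasurable_sum. Qed.

Lemma lyap_ge x : (b x <= lyap x)%E.
Proof.
apply: le_trans (nneseries_lim_ge 1 (fun t _ _ => term0 t x)).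
by rewrite big_nat1 expr0 mul1e.
Qed.

Lemma KopE_lyap_le x : (KopE K lyap x <= 2%:E * lyap x)%E.
Proof.
rewrite /KopE {1}/lyap integral_nneseries//.
apply: lime_le.
  by apply: is_cvg_nneseries => t _ _; exact: integral_ge0.
apply: nearW => n.
apply: (@le_trans _ _ (2%:E *
    \sum_(0 <= t < n.+1) ((2^-1 ^+ t)%:E * iter t (KopE K) b x))%E); last first.
  by rewrite lee_wpmul2l ?lee_fin//; apply: nneseries_lim_ge => t _ _.
rewrite big_nat_recl// ge0_muleDr//; last by apply: sume_ge0 => t _.
rewrite -[leLHS]add0e; apply: leeD; first by rewrite mule_ge0 ?lee_fin.
rewrite ge0_sume_distrr//; apply: lee_sum => t _.
rewrite ge0_integralZl ?lee_fin ?exprn_ge0//; last 2 first.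
- exact: measurable_iter_KopE.
- by move=> y _; exact: iter_KopE_ge0.
by rewrite muleA -EFinM exprS mulrA divff// mul1r.
Qed.

Lemma integral_lyap_lty (mu : {measure set E -> \bar R}) :
  (forall A, measurable A -> (\int[mu]_x K x A = mu A)%E) ->
  (\int[mu]_x b x < +oo)%E -> (\int[mu]_x lyap x < +oo)%E.
Proof.
move=> Kmu bmu; rewrite /lyap integral_nneseries//.
have bfin : (\int[mu]_x b x)%E \is a fin_num.
  by rewrite ge0_fin_numE//; apply: integral_ge0 => x _.
set v := fine (\int[mu]_x b x)%E.
have v0 : 0 <= v by rewrite fine_ge0//; apply: integral_ge0 => x _.
have -> : (\sum_(t <oo) \int[mu]_x ((2^-1 ^+ t)%:E * iter t (KopE K) b x) =
    \sum_(t <oo) (2^-1 ^+ t * v)%:E)%E.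
  apply: eq_eseriesr => t _; rewrite ge0_integralZl ?lee_fin ?exprn_ge0//; last 2 first.
  - exact: measurable_iter_KopE.
  - by move=> x _; exact: iter_KopE_ge0.
  by rewrite integral_iter_KopE// EFinM fineK.
apply: (@le_lt_trans _ _ (2 * v)%:E); last exact: ltry.
apply: lime_le.
  by apply: is_cvg_nneseries => n _ _; rewrite lee_fin mulr_ge0// exprn_ge0.
apply: nearW => n; rewrite sumEFin lee_fin -mulr_suml ler_wpM2r//.
apply: (@le_trans _ _ (2 - 2 * 2^-1 ^+ n)).
  elim: n => [|n IH]; first by rewrite big_geq// expr0 mulr1 subrr.
  rewrite big_nat_recr//= exprS; lra.
by rewrite lerBlDr lerDl mulr_ge0// exprn_ge0.
Qed.

End lyapunov_series.

Section harris_slln.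
Context {R : realType} {d : nat}.
Notation E := (Rd R d).
Variable K : R.-pker E ~> E.
Variable mu : {measure set E -> \bar R}.
Hypothesis Kmu : forall A, measurable A -> (\int[mu]_x K x A = mu A)%E.
Hypotheses (mu0 : (0 < mu setT)%E) (muoo : (mu setT < +oo)%E).
Hypothesis harris : harris_recurrent K.
Context {dO : measure_display} {O : measurableType dO} (P : probability O R).
Variable X : nat -> O -> E.
Hypothesis chainX : markov_chain P X K.

Section centered.
Variable g : E -> R.
Hypothesis mg : measurable_fun setT g.
Hypothesis g2 : mu.-integrable setT (fun x => (g x ^+ 2)%:E).

(** The summand 1 provides U >= 1, so that constants are dominated; the summand g^2 makes g
    square-dominated. *)
Let b x : \bar R := (1 + g x ^+ 2)%:E.
Let U := lyap K b.

Let mb : measurable_fun setT b.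
Proof. by apply/measurable_EFinP; apply: measurable_funD => //; exact: measurable_funX. Qed.

Let b1 x : (1 <= b x)%E.
Proof. by rewrite lee_fin lerDl sqr_ge0. Qed.

Lemma lyap_sqr_props : [/\ measurable_fun setT U, (forall x, (1 <= U x)%E),
  (forall x, (KopE K U x <= 2%:E * U x)%E) & (\int[mu]_x U x < +oo)%E].
Proof.
split.
- exact: measurable_lyap.
- by move=> x; exact: le_trans (b1 x) (lyap_ge K b1 x).
- exact: KopE_lyap_le.
- apply: integral_lyap_lty => //.
  rewrite /b; under eq_integral do rewrite EFinD.
  rewrite ge0_integralD//; [|by move=> x _; rewrite lee_fin sqr_ge0|].
    rewrite integral_cst// mul1e lte_add_pinfty//.
    by have := integrable_lty measurableT g2.
  by apply/measurable_EFinP; exact: measurable_funX.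
Qed.

Lemma dom2_lyap_sqr : dom2 U g.
Proof.
split => //; split; first exact: measurable_funX.
exists 1 => // x; rewrite mul1e; apply: le_trans (lyap_ge K b1 x).
by rewrite lee_fin ger0_norm ?sqr_ge0// lerDr.
Qed.

Variable B : R.
Hypothesis HB : forall N, Rintegral mu setT (fun x => g x ^+ 2) +
  2 * \sum_(k < N) Rintegral mu setT (fun x => g x * iter k.+1 (Kop K) g x) <= B.

(** Where U is finite, this is the mean of [sqblock] of g along the chain started at x. The absolute
    value keeps it nonnegative at the other points too, where [sqsum] has no guaranteed sign. *)
Let T n x : \bar R := ((n.+1%:R ^- 4)%:E * `|sqsum K g (n.+1 ^ 2) x|%:E +
  (n.+1%:R ^- 3)%:E *
    \sum_(n.+1 ^ 2 <= t < n.+2 ^ 2) iter t (KopE K) (fun y => (g y ^+ 2)%:E) x)%E.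

Let g20 x : (0 <= (g x ^+ 2)%:E)%E. Proof. by rewrite lee_fin sqr_ge0. Qed.

Let mg2 : measurable_fun setT (fun y => (g y ^+ 2)%:E).
Proof. by apply/measurable_EFinP; exact: measurable_funX. Qed.

Let i3_ge0 n : (0 <= (n.+1%:R ^- 3 : R)%:E)%E.
Proof. by rewrite lee_fin invr_ge0 exprn_ge0. Qed.

Let i4_ge0 n : (0 <= (n.+1%:R ^- 4 : R)%:E)%E.
Proof. by rewrite lee_fin invr_ge0 exprn_ge0. Qed.

Let S0 n x : (0 <= \sum_(n.+1 ^ 2 <= t < n.+2 ^ 2)
  iter t (KopE K) (fun y => (g y ^+ 2)%:E) x)%E.
Proof. by apply: sume_ge0 => t _; exact: iter_KopE_ge0. Qed.

Let mS n : measurable_fun setT (fun x => \sum_(n.+1 ^ 2 <= t < n.+2 ^ 2)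
  iter t (KopE K) (fun y => (g y ^+ 2)%:E) x)%E.
Proof. by apply: emeasurable_sum => t; exact: measurable_iter_KopE. Qed.

Let msq N : measurable_fun setT (sqsum K g N).
Proof.
have [mU U1 KU _] := lyap_sqr_props.
by have [] := dom_sqsum mU U1 (ltr0n _ 2) KU N dom2_lyap_sqr.
Qed.

Let mabs N : measurable_fun setT (fun x => `|sqsum K g N x|%:E).
Proof. by apply/measurable_EFinP; exact: measurableT_comp. Qed.

Let T0 n x : (0 <= T n x)%E.
Proof. by rewrite adde_ge0// mule_ge0. Qed.

Let mT n : measurable_fun setT (T n).
Proof. by apply: emeasurable_funD; apply: measurable_funeM. Qed.

Lemma integral_sqsum_le N :
  (\int[mu]_x `|sqsum K g N x|%:E <= (N%:R * B)%:E)%E.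
Proof.
have [mU U1 KU Umu] := lyap_sqr_props; have dg := dom2_lyap_sqr.
have ds := dom_sqsum mU U1 (ltr0n _ 2) KU N dg.
have is_ := dom_integrableT mU U1 Umu ds.
have intU : mu.-integrable setT U.
  apply/integrableP; split => //.
  by under eq_integral do rewrite gee0_abs ?(le_trans _ (U1 _))//.
have -> : (\int[mu]_x `|sqsum K g N x|%:E = \int[mu]_x (sqsum K g N x)%:E)%E.
  apply: ae_eq_integral => //; first exact/measurable_EFinP.
  apply: filterS (integrable_ae measurableT intU) => x /(_ Logic.I) Ux _.
  congr (_%:E); rewrite ger0_norm//.
  apply: (sqsum_ge0 mU U1 (ltr0n _ 2) KU) => //.
  by rewrite -ge0_fin_numE// (le_trans _ (U1 _)).
rewrite -[leLHS]fineK; last exact: integrable_fin_num.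
rewrite lee_fin [leLHS](Rintegral_sqsum mU U1 (ltr0n _ 2) KU Kmu Umu)//.
rewrite mulr_natl -[in leRHS](card_ord N) -sumr_const; apply: ler_sum => n _.
by rewrite (Rintegral_sqincr mU U1 (ltr0n _ 2) KU Umu).
Qed.

Lemma integral_term_le : exists2 C : R, 0 <= C &
  forall n, (\int[mu]_x T n x <= (C / n.+1%:R ^+ 2)%:E)%E.
Proof.
have vfin : (\int[mu]_x (g x ^+ 2)%:E)%E \is a fin_num by exact: integrable_fin_num.
set v := fine (\int[mu]_x (g x ^+ 2)%:E)%E.
have v0 : 0 <= v by rewrite fine_ge0//; apply: integral_ge0 => x _.
have B0 : 0 <= B.
  by have := HB 0; rewrite big_ord0 mulr0 addr0; exact: le_trans.
(* With a = n + 1, the first summand contributes a^-4 * a^2 * B, and the second a^-3 times at most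
   3a stationary means, each equal to v. Both are of order a^-2. *)
exists (B + 3 * v); first by rewrite addr_ge0// mulr_ge0.
move=> n; rewrite /T ge0_integralD//;
  try by [move=> x _; rewrite mule_ge0|exact: measurable_funeM].
rewrite !ge0_integralZl//.
have a0 : 0 < n.+1%:R :> R by rewrite ltr0n.
have -> : (B + 3 * v) / n.+1%:R ^+ 2 = n.+1%:R ^- 4 * ((n.+1 ^ 2)%:R * B) +
    n.+1%:R ^- 3 * (3 * n.+1%:R * v).
  by rewrite natrX; field; rewrite gt_eqF.
rewrite EFinD !EFinM; apply: leeD; rewrite -!EFinM.
  by rewrite [leRHS]EFinM lee_wpmul2l// integral_sqsum_le.
rewrite [leRHS]EFinM lee_wpmul2l// ge0_integral_sum//; last 2 first.
- by move=> t; exact: measurable_iter_KopE.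
- by move=> t x _; exact: iter_KopE_ge0.
under eq_bigr do rewrite integral_iter_KopE// -(fineK vfin) -/v.
rewrite sumEFin lee_fin sumr_const_nat -(mulr_natl v) ler_wpM2r//.
by rewrite -natrM ler_nat leq_subLR -!mulnn; lia.
Qed.

(* If [G x] is finite then, for the chain started at [x], the terms [sqblock]
   along the trajectory are summable in mean, hence tend to 0 almost surely. *)
Let G x : \bar R := (U x + \sum_(n <oo) T n x)%E.

Let mG : measurable_fun setT G.
Proof.
have [mU _ _ _] := lyap_sqr_props; apply: emeasurable_funD => //.
exact: ge0_emeasurable_sum.
Qed.

Let sT0 x : (0 <= \sum_(n <oo) T n x)%E.
Proof. exact: nneseries_ge0. Qed.

Let G0 x : (0 <= G x)%E.
Proof.
by have [_ U1 _ _] := lyap_sqr_props; rewrite adde_ge0// (le_trans _ (U1 x)).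
Qed.

Lemma integral_G_lty : (\int[mu]_x G x < +oo)%E.
Proof.
have [mU U1 _ Umu] := lyap_sqr_props; have [C C0 HC] := integral_term_le.
rewrite /G ge0_integralD//; last 2 first.
- by move=> x _; rewrite (le_trans _ (U1 x)).
- exact: ge0_emeasurable_sum.
rewrite lte_add_pinfty// integral_nneseries//.
apply: le_lt_trans (nneseries_inv_sqr_lty C0).
by apply: lee_nneseries => // n _ _; exact: integral_ge0.
Qed.

(** The law of X_k is arbitrary, so G(X_k) need not be integrable. On the event G(X_k) <= M it is
    bounded, hence so are U(X_k) and the mean of the sum of all [sqblock] terms of the chain from
    time k on. That sum is then almost surely finite on the event, and its terms tend to 0. *)
Lemma average_from_bounded k (M : nat) :
  {ae P, forall w, (G (X k w) <= M%:R%:E)%E ->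
    (N%:R^-1 * \sum_(t < N) g (X (k + t)%N w)) @[N --> \oo] --> 0}.
Proof.
have [mU U1 KU Umu] := lyap_sqr_props; have dg := dom2_lyap_sqr.
pose Y t := X (k + t)%N.
pose A := [set x | (G x <= M%:R%:E)%E].
have mA : measurable A by rewrite -[A]setTI; exact: emeasurable_fun_infty_c.
have HY0 : markov_on K P setT Y.
  have shiftn j : markov_on K P setT (fun t => X (j + t)%N).
    elim: j => [|j IH]; first exact: markov_chain_on.
    have := markov_on_shift IH.
    by rewrite (_ : (fun t => _) = (fun t => X (j.+1 + t)%N))//;
      apply/funext => t; rewrite addnS.
  exact: shiftn.
have HY := markov_on_init mA HY0.
set D := setT `&` Y 0%N @^-1` A in HY.
have [mD mY _] := HY.
have GM : (\int[P]_(w in D) G (Y 0%N w) <= M%:R%:E)%E.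
  apply: (@le_trans _ _ (\int[P]_(w in D) M%:R%:E)%E).
    apply: ge0_le_integral => //; last by move=> w [].
    by apply: measurable_funTS; exact: measurableT_comp.
  by rewrite integral_cst// -[leRHS]mule1 lee_wpmul2l ?lee_fin// probability_le1.
have mYD (u : E -> \bar R) : measurable_fun setT u ->
    measurable_fun D (fun w => u (Y 0%N w)).
  by move=> mu_; apply: measurable_funTS; exact: measurableT_comp.
have HS : dom_start K U P D Y.
  split => //; apply: le_lt_trans (ltry M%:R); apply: le_trans GM.
  apply: ge0_le_integral => //; [|exact: mYD|exact: mYD|].
    by move=> w _; rewrite (le_trans _ (U1 _)).
  by move=> w _; rewrite leeDl.
pose Z n w := sqblock (fun t => g (Y t w)) n.
have mgY t : measurable_fun setT (fun w => g (Y t w)) by exact: measurableT_comp.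
have Z0 n w : 0 <= Z n w.
  apply: addr_ge0; apply: mulr_ge0; rewrite ?sqr_ge0 ?invr_ge0 ?exprn_ge0//.
  by apply: sumr_ge0 => t _; exact: sqr_ge0.
have mZ n : measurable_fun setT (fun w => (Z n w)%:E).
  apply/measurable_EFinP; apply: measurable_funD; apply: measurable_funM => //.
    by apply: measurable_funX; apply: measurable_sum => t.
  by apply: measurable_sum => t; exact: measurable_funX.
have ZT n : (\int[P]_(w in D) (Z n w)%:E <= \int[P]_(w in D) T n (Y 0%N w))%E.
  have msq2 : measurable_fun D (fun w => ((\sum_(t < n.+1 ^ 2) g (Y t w)) ^+ 2)%:E).
    apply: measurable_funTS; apply/measurable_EFinP; apply: measurable_funX.
    by apply: measurable_sum => t.
  have mgt t : measurable_fun D (fun w => (g (Y t w) ^+ 2)%:E).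
    by apply: measurable_funTS; apply/measurable_EFinP; exact: measurable_funX.
  have mgs : measurable_fun D
      (fun w => \sum_(n.+1 ^ 2 <= t < n.+2 ^ 2) (g (Y t w) ^+ 2)%:E)%E.
    exact: emeasurable_sum.
  have -> : (\int[P]_(w in D) (Z n w)%:E = \int[P]_(w in D)
      ((n.+1%:R ^- 4)%:E * ((\sum_(t < n.+1 ^ 2) g (Y t w)) ^+ 2)%:E +
       (n.+1%:R ^- 3)%:E *
         \sum_(n.+1 ^ 2 <= t < n.+2 ^ 2) (g (Y t w) ^+ 2)%:E))%E.
    by apply: eq_integral => w _; rewrite sumEFin -!EFinM -EFinD.
  rewrite ge0_integralD//; try by [move=> w _; rewrite mule_ge0// lee_fin sqr_ge0
    |exact: measurable_funeM|move=> w _; rewrite mule_ge0//; exact: sume_ge0].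
  have m1 := mYD _ (mabs (n.+1 ^ 2)); have m2 := mYD _ (mS n).
  rewrite /T [leRHS]ge0_integralD//; try by [move=> w _; rewrite mule_ge0
    |exact: measurable_funeM].
  rewrite !ge0_integralZl//; try by [move=> w _; rewrite lee_fin sqr_ge0
    |move=> w _; exact: sume_ge0].
  apply: leeD; rewrite lee_wpmul2l//.
    have iS := integrable_sqr_sum mU U1 (ltr0n _ 2) KU (n.+1 ^ 2)%N HS dg.
    have iq := dom_integrable_state mU U1 (ltr0n _ 2) KU 0%N HS
      (dom_sqsum mU U1 (ltr0n _ 2) KU (n.+1 ^ 2)%N dg).
    rewrite -[leLHS]fineK; last exact: integrable_fin_num.
    rewrite [X in X%:E](Rintegral_sqr_sum mU U1 (ltr0n _ 2) KU (n.+1 ^ 2)%N HS dg).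
    rewrite fineK; last exact: integrable_fin_num.
    apply: le_integral => //; first exact: integrable_norm iq.
    by move=> w _; rewrite lee_fin ler_norm.
  have mKt t := mYD _ (measurable_iter_KopE K t g20 mg2).
  rewrite !ge0_integral_sum//; try by [move=> t w _; exact: iter_KopE_ge0
    |move=> t w _; rewrite lee_fin sqr_ge0].
  apply: lee_sum => t _.
  by rewrite (integral_markov_iter t HY (h := fun x => (g x ^+ 2)%:E)).
have iZ : P.-integrable D (fun w => \sum_(n <oo) (Z n w)%:E)%E.
  have sZ0 w : (0 <= \sum_(n <oo) (Z n w)%:E)%E.
    by apply: nneseries_ge0 => n _ _; rewrite lee_fin.
  apply/integrableP; split.
    apply: measurable_funTS; apply: ge0_emeasurable_sum => //.
    by move=> n w _ _; rewrite lee_fin.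
  under eq_integral do rewrite gee0_abs//.
  rewrite integral_nneseries//; last 2 first.
  - by move=> n; exact: measurable_funTS.
  - by move=> n w _; rewrite lee_fin.
  apply: (@le_lt_trans _ _ (\sum_(n <oo) \int[P]_(w in D) T n (Y 0%N w))%E).
    apply: lee_nneseries => // n _ _.
    by apply: integral_ge0 => w _; rewrite lee_fin.
  rewrite -integral_nneseries//; last by move=> n; exact: mYD.
  apply: le_lt_trans (ltry M%:R); apply: le_trans GM.
  apply: ge0_le_integral => //; [|exact: mYD|].
    by apply: (mYD (fun x => \sum_(n <oo) T n x)%E); exact: ge0_emeasurable_sum.
  by move=> w _; rewrite leeDr// (le_trans _ (U1 _)).
apply: filterS (integrable_ae mD iZ) => w Hw Gw.
apply: (@cvg_average0 R (fun t => g (X (k + t)%N w))).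
apply: (@nneseries_lty_cvg0 R (fun n => Z n w)) => //.
have : D w by split => //=; rewrite /A/= /Y addn0.
move=> /Hw; rewrite ge0_fin_numE//.
by apply: nneseries_ge0 => n _ _; rewrite lee_fin.
Qed.

Lemma harris_slln_centered :
  {ae P, forall w, (N%:R^-1 * \sum_(t < N) g (X t w)) @[N --> \oo] --> 0}.
Proof.
pose A := [set x | (G x < +oo)%E].
have mA : measurable A by rewrite -[A]setTI; exact: emeasurable_fun_infty_o.
have muA : mu (~` A) = 0%E.
  have iG : mu.-integrable setT G.
    apply/integrableP; split => //.
    by under eq_integral do rewrite gee0_abs//; exact: integral_G_lty.
  apply/negligibleP; first exact: measurableC.
  apply: negligibleS (integrable_ae measurableT iG) => x /= Ax.
  by move=> /(_ Logic.I); rewrite ge0_fin_numE.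
have hits := markov_chain_hits chainX mA (harris_full_Lret harris Kmu mu0 mA muA).
(* The entrance time k and the level M depend on the trajectory, so one null set must serve all
   pairs; both range over the naturals to make this a countable intersection. *)
have all_ : {ae P, forall w (k M : nat), (G (X k w) <= M%:R%:E)%E ->
    (N%:R^-1 * \sum_(t < N) g (X (k + t)%N w)) @[N --> \oo] --> 0}.
  by apply: ae_foralln => k; apply: ae_foralln => M; exact: average_from_bounded.
apply: filterS2 hits all_ => w [k Gk] H.
apply: (cvg_average_shift (k := k) (x := fun t => g (X t w))).
apply: (H k (Num.truncn (fine (G (X k w)))).+1).
rewrite -[leLHS]fineK ?ge0_fin_numE// lee_fin ltW//.
exact: truncnS_gt.
Qed.

End centered.
End harris_slln.

(** * Centering *)

Section harris_slln_uncentered.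
Context {R : realType} {d : nat}.
Notation E := (Rd R d).
Variable K : R.-pker E ~> E.
Variable mu : {measure set E -> \bar R}.
Hypothesis Kmu : forall A, measurable A -> (\int[mu]_x K x A = mu A)%E.
Hypotheses (mu0 : (0 < mu setT)%E) (muoo : (mu setT < +oo)%E).

Section lagged_covariance.
Variable f : E -> R.
Hypothesis mf : measurable_fun setT f.
Hypothesis f2 : mu.-integrable setT (fun x => (f x ^+ 2)%:E).

Let M := fine (mu setT).
Let m := Rintegral mu setT f / M.
Let g x := f x - m.

Let M0 : 0 < M. Proof. by apply: fine_gt0; rewrite mu0. Qed.

Let mg : measurable_fun setT g.
Proof. exact: measurable_funB. Qed.

Let cst_integrable r : mu.-integrable setT (fun=> r%:E).
Proof.
apply/integrableP; split; first exact: measurable_cst.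
by rewrite integral_cst// lte_mul_pinfty.
Qed.

Lemma integrable_sqr_sub r : mu.-integrable setT (fun x => ((f x - r) ^+ 2)%:E).
Proof.
have i1 := integrableZl measurableT 2 (integrableD measurableT f2 (cst_integrable (r ^+ 2))).
apply: (le_integrable measurableT _ _ i1).
  by apply/measurable_EFinP; apply: measurable_funX; exact: measurable_funB.
move=> x _ /=; rewrite lee_fin ger0_norm ?sqr_ge0// ger0_norm; last first.
  by rewrite mulr_ge0// addr_ge0// sqr_ge0.
by rewrite -subr_ge0 (_ : _ - _ = (f x + r) ^+ 2) ?sqr_ge0//; ring.
Qed.

Let g2 := integrable_sqr_sub m.

Let U := lyap K (fun x => (1 + g x ^+ 2)%:E).

Let Ug : [/\ measurable_fun setT U, (forall x, (1 <= U x)%E),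
  (forall x, (KopE K U x <= 2%:E * U x)%E) & (\int[mu]_x U x < +oo)%E].
Proof. exact: lyap_sqr_props. Qed.

Let dg : dom2 U g.
Proof. exact: dom2_lyap_sqr. Qed.

Let df : dom2 U f.
Proof.
have [mU U1 _ _] := Ug; have -> : f = (fun x => g x + m).
  by apply/funext => x; rewrite subrK.
exact: (dom2D dg (dom2_cst U1 m)).
Qed.

(** K fixes constants. Splitting off -m at each step uses additivity of [Kop], hence finiteness of
    U. *)
Let iter_Kop_center k x : (U x < +oo)%E ->
  iter k (Kop K) g x = iter k (Kop K) f x - m.
Proof.
have [mU U1 KU _] := Ug; have c0 : 0 < 2 :> R by [].
have dfk := dom_iter_Kop mU U1 c0 KU _ (dom2W U1 df).
have dgk := dom_iter_Kop mU U1 c0 KU _ (dom2W U1 dg).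
have dm := dom_cst U1 (- m).
elim: k x => [//|k IH] x Ux /=.
rewrite (@Kop_eq _ _ K U 2 mU U1 c0 KU _ (fun y => iter k (Kop K) f y + - m))//.
  by rewrite (KopD mU U1 c0 KU (dfk k) dm Ux) Kop_cst.
exact: domD.
Qed.

(** By invariance the iterate K^k f has the same integral as f, so the two cross terms and m^2
    combine to -m^2. The factors M appear because mu is not normalized. *)
Lemma Rintegral_lag_center k :
  Rintegral mu setT (fun x => g x * iter k (Kop K) g x) =
  M * (Rintegral mu setT (fun x => f x * iter k (Kop K) f x) / M - m ^+ 2).
Proof.
have [mU U1 KU Umu] := Ug; have c0 : 0 < 2 :> R by [].
have df1 := dom2W U1 df.
have dfk := dom_iter_Kop mU U1 c0 KU k df1.
have dff := dom2M df (dom2_iter_Kop mU U1 c0 KU k df).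
have ig := dom_integrableT mU U1 Umu (dom2M dg (dom2_iter_Kop mU U1 c0 KU k dg)).
have dh : dom U (fun x => f x * iter k (Kop K) f x - m * iter k (Kop K) f x - m * f x + m ^+ 2).
  by apply: domD (dom_cst U1 _); do ![apply: domD => //]; under eq_fun do
    rewrite -mulNr; apply: domZ.
have intU : mu.-integrable setT U.
  apply/integrableP; split => //.
  by under eq_integral do rewrite gee0_abs ?(le_trans _ (U1 _))//.
have Ik : Rintegral mu setT (iter k (Kop K) f) = Rintegral mu setT f.
  elim: (k) => //= j IH.
  by rewrite (Rintegral_Kop mU U1 c0 KU Kmu Umu (dom_iter_Kop mU U1 c0 KU j df1)).
transitivity (Rintegral mu setT (fun x =>
    f x * iter k (Kop K) f x - m * iter k (Kop K) f x - m * f x + m ^+ 2)).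
  rewrite /Rintegral; congr fine; apply: ae_eq_integral => //.
  - exact: measurable_int ig.
  - by apply/measurable_EFinP; case: dh.
  apply: filterS (integrable_ae measurableT intU) => x /(_ Logic.I) Ux _.
  congr (_%:E); rewrite iter_Kop_center; first by rewrite /g; ring.
  by rewrite -ge0_fin_numE// (le_trans _ (U1 _)).
have i1 := dom_integrableT mU U1 Umu dff.
have i2 := dom_integrableT mU U1 Umu dfk.
have i3 := dom_integrableT mU U1 Umu df1.
have i2m := integrableZl measurableT m i2; have i3m := integrableZl measurableT m i3.
have i12 := integrableB measurableT i1 i2m.
have i123 := integrableB measurableT i12 i3m.
rewrite (RintegralD measurableT i123 (cst_integrable _)).
rewrite (RintegralB measurableT i12 i3m) (RintegralB measurableT i1 i2m).
rewrite Rintegral_cst// RintegralZl// RintegralZl//.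
rewrite [X in _ - m * X - _](_ : _ = Rintegral mu setT f)//.
have -> : Rintegral mu setT f = m * M by rewrite /m divfK// gt_eqF.
by rewrite -/M; field; rewrite gt_eqF.
Qed.

End lagged_covariance.

Lemma harris_slln (f : E -> R) (c : nat -> R) (B : R)
    {dO : measure_display} {O : measurableType dO} (P : probability O R)
    (X : nat -> O -> E) :
  harris_recurrent K -> markov_chain P X K ->
  measurable_fun setT f -> mu.-integrable setT (fun x => (f x ^+ 2)%:E) ->
  (forall k, c k = Rintegral mu setT (fun x => f x * iter k (Kop K) f x) /
     fine (mu setT) - (Rintegral mu setT f / fine (mu setT)) ^+ 2) ->
  (forall N, c 0%N + 2 * \sum_(k < N) c k.+1 <= B) ->
  {ae P, forall w, (n%:R^-1 * \sum_(t < n) f (X t w)) @[n --> \oo] -->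
    Rintegral mu setT f / fine (mu setT)}.
Proof.
move=> harris chainX mf f2 cE cB.
set m := Rintegral mu setT f / _ in cE *.
have M0 : 0 < fine (mu setT) by apply: fine_gt0; rewrite mu0.
have mg : measurable_fun setT (fun x => f x - m) by exact: measurable_funB.
have g2 := integrable_sqr_sub mf f2 m.
have H : forall N, Rintegral mu setT (fun x => (f x - m) ^+ 2) +
    2 * \sum_(k < N) Rintegral mu setT (fun x => (f x - m) *
      iter k.+1 (Kop K) (fun y => f y - m) x) <= fine (mu setT) * B.
  move=> N; have E0 := Rintegral_lag_center mf f2 0.
  have -> : Rintegral mu setT (fun x => (f x - m) ^+ 2) = fine (mu setT) * c 0%N.
    by rewrite cE -E0; apply: eq_Rintegral => x _; rewrite expr2.
  have -> : \sum_(k < N) Rintegral mu setT (fun x => (f x - m) *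
      iter k.+1 (Kop K) (fun y => f y - m) x) = fine (mu setT) * \sum_(k < N) c k.+1.
    by rewrite mulr_sumr; apply: eq_bigr => k _; rewrite cE -Rintegral_lag_center.
  by rewrite mulrCA -mulrDr ler_wpM2l// ltW.
apply: filterS (harris_slln_centered Kmu mu0 muoo harris chainX mg g2 H) => w Hw.
rewrite -[X in _ --> X]addr0.
(* The identity starts at n + 1: the empty average is 0 by convention, while the right-hand side
   would be m. *)
have : (fun n : nat => (n.+1%:R^-1 * \sum_(t < n.+1) f (X t w))) =
    (fun n => m + n.+1%:R^-1 * \sum_(t < n.+1) (f (X t w) - m)).
  apply/funext => n.
  have -> : \sum_(t < n.+1) (f (X t w) - m) =
      \sum_(t < n.+1) f (X t w) - n.+1%:R * m.
    by rewrite sumrB sumr_const card_ord mulr_natl.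
  by rewrite mulrBr mulKf ?pnatr_eq0// addrC subrK.
move=> Hn; rewrite -cvg_shiftS Hn; apply: cvgD; first exact: cvg_cst.
by rewrite (cvg_shiftS (fun n => n%:R^-1 * \sum_(t < n) (f (X t w) - m))).
Qed.

End harris_slln_uncentered.

(** * Measures with a density *)

(** Measurability and nonnegativity of the density are arguments, so that the measure structure
    declared below can draw on them. *)
Definition mdensity d (T : measurableType d) (R : realType)
    (mu : {measure set T -> \bar R}) (u : T -> R)
    (mu_ : measurable_fun setT u) (u0 : forall x, 0 <= u x) (A : set T) : \bar R :=
  (\int[mu]_(x in A) (u x)%:E)%E.

Section mdensity.
Context d (T : measurableType d) (R : realType).
Variables (mu : {measure set T -> \bar R}) (u : T -> R).
Hypotheses (mu_ : measurable_fun setT u) (u0 : forall x, 0 <= u x).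

Let mEu : measurable_fun setT (fun x => (u x)%:E).
Proof. exact/measurable_EFinP. Qed.

Let density0 : mdensity mu mu_ u0 set0 = 0%E.
Proof. by rewrite /mdensity integral_set0. Qed.

Let density_ge0 A : (0 <= mdensity mu mu_ u0 A)%E.
Proof. by apply: integral_ge0 => x _; rewrite lee_fin. Qed.

Let density_sigma_additive : semi_sigma_additive (mdensity mu mu_ u0).
Proof.
move=> F mF tF mUF; rewrite /mdensity ge0_integral_bigcup//; last 2 first.
- exact: measurable_funTS.
- by move=> x _; rewrite lee_fin.
by apply: is_cvg_nneseries => n _ _; exact: density_ge0.
Qed.

HB.instance Definition _ := isMeasure.Build _ _ _ (mdensity mu mu_ u0)
  density0 density_ge0 density_sigma_additive.

Lemma ge0_integral_mdensity (h : T -> \bar R) :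
  (forall x, (0 <= h x)%E) -> measurable_fun setT h ->
  (\int[mdensity mu mu_ u0]_x h x = \int[mu]_x ((u x)%:E * h x))%E.
Proof.
apply: (@ge0_measurable_ind _ T R (fun h =>
  (\int[mdensity mu mu_ u0]_x h x = \int[mu]_x ((u x)%:E * h x))%E)).
- move=> A mA; rewrite integral_indic// setIT.
  transitivity (\int[mu]_(x in A) (u x)%:E)%E => //; rewrite [LHS]integral_mkcond.
  apply: eq_integral => x _; rewrite patchE indicE.
  by case: ifP => _; rewrite ?mule1 ?mule0.
- move=> c v c0 v0 mv IH; rewrite ge0_integralZl// IH -ge0_integralZl//;
    try by [exact: emeasurable_funM|move=> x _; rewrite mule_ge0// lee_fin].
  by apply: eq_integral => x _; rewrite muleCA.
- move=> h1 h2 h10 h20 m1 m2 IH1 IH2; rewrite ge0_integralD// IH1 IH2.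
  rewrite -ge0_integralD//; try by [move=> x _; rewrite mule_ge0// lee_fin
    |exact: emeasurable_funM].
  by apply: eq_integral => x _; rewrite ge0_muleDr.
- move=> v v0 mv ndv IH; rewrite monotone_convergence//.
  under eq_fun do rewrite IH.
  rewrite -monotone_convergence//; first last.
  + by move=> x _ m n mn; rewrite lee_wpmul2l ?lee_fin ?ndv.
  + by move=> n x _; rewrite mule_ge0// lee_fin.
  + by move=> n; exact: emeasurable_funM.
  apply: eq_integral => x _; rewrite muleC -nd_limeMr ?lee_fin//.
  by under eq_fun do rewrite muleC.
Qed.

Lemma Rintegral_mdensity (h : T -> R) : measurable_fun setT h ->
  Rintegral (mdensity mu mu_ u0) setT h = Rintegral mu setT (fun x => h x * u x).
Proof.
move=> mh; have mEh : measurable_fun setT (EFin \o h) by exact/measurable_EFinP.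
rewrite /Rintegral integralE [in RHS]integralE; congr (fine (_ - _)).
  rewrite ge0_integral_mdensity//; last exact: measurable_funepos.
  apply: eq_integral => x _; rewrite !funeposE /= maxe_pMr ?lee_fin//.
  by rewrite mule0 muleC.
rewrite ge0_integral_mdensity//; last exact: measurable_funeneg.
apply: eq_integral => x _; rewrite !funenegE /= maxe_pMr ?lee_fin//.
by rewrite mule0 -EFinM mulrN mulrC.
Qed.

Lemma integrable_mdensity (h : T -> R) : measurable_fun setT h ->
  mu.-integrable setT (fun x => (h x * u x)%:E) ->
  (mdensity mu mu_ u0).-integrable setT (EFin \o h).
Proof.
move=> mh /integrableP[_ ih]; apply/integrableP.
have mEh : measurable_fun setT (EFin \o h) by exact/measurable_EFinP.
split => //; rewrite ge0_integral_mdensity//; last exact: measurableT_comp.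
apply: le_lt_trans ih; rewrite le_eqVlt; apply/orP; left; apply/eqP.
apply: eq_integral => x _; rewrite EFinM abseM muleC; congr (_ * _)%E.
by rewrite gee0_abs ?lee_fin.
Qed.

End mdensity.

(** * Moreau-Yosida envelopes *)

Section moreau.
Context {R : realType} {d : nat}.
Notation E := (Rd R d).
Variables (psi : E -> \bar R) (lam : R).
Hypotheses (Hproper : proper_fun psi) (Hbdd : bounded_below psi) (Hlam : 0 < lam).

Lemma moreau_fin x : moreau psi lam x \is a fin_num.
Proof.
have [c Hc] := Hbdd; have [_ [x0 px0]] := Hproper.
rewrite fin_numE; apply/andP; split.
  rewrite -ltNye; apply: (@lt_le_trans _ _ c%:E); first exact: ltNyr.
  apply: le_ereal_inf_tmp => _ [y _ <-]; apply: le_trans (Hc y) _.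
  rewrite leeDl// lee_fin divr_ge0//; last by rewrite mulr_ge0// ltW.
  by apply: sumr_ge0 => i _; exact: sqr_ge0.
rewrite -ltey; apply: (@le_lt_trans _ _
  (psi x0 + (sqnorm ((x0 : vec R d) - (x : vec R d)) / (2 * lam))%:E)%E).
  by apply: ereal_inf_lbound; exists x0.
by rewrite lte_add_pinfty ?ltry// ltey.
Qed.

Lemma continuous_sqnorm_sub (y : vec R d) :
  continuous (fun x : vec R d => sqnorm (y - x)).
Proof.
rewrite /sqnorm; apply: continuous_big => [|i _]; first exact: add_continuous.
have -> : (fun x : vec R d => (y - x) ord0 i ^+ 2) =
    (fun x => (y ord0 i - x ord0 i) * (y ord0 i - x ord0 i)).
  by apply/funext => x; rewrite !mxE expr2.
move=> x; have cx : x0 ord0 i @[x0 --> x] --> x ord0 i by exact: coord_continuous.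
have cB : (y ord0 i - x0 ord0 i) @[x0 --> x] --> (y ord0 i - x ord0 i).
  by apply: (cvgB _ cx); exact: cvg_cst.
exact: (cvgM cB cB).
Qed.

(** The infimum runs over uncountably many y, but the strict sublevel set {psi^lambda < r} is a
    union over y of sets open in x, hence open, and such sets generate the sigma-algebra. *)
Lemma measurable_moreau : measurable_fun setT (moreau psi lam).
Proof.
apply: (measurability _ (ErealGenInftyO.measurableE R)) => _ [_ [r ->] <-].
rewrite setTI; apply: sub_sigma_algebra.
have -> : moreau psi lam @^-1` `]-oo, r%:E[%classic =
    \bigcup_y [set x : vec R d |
      (psi y + (sqnorm ((y : vec R d) - x) / (2 * lam))%:E < r%:E)%E].
  apply/seteqP; split => x /=.
    by rewrite in_itv/= => /ereal_inf_ltP[_ [y _ <-] yr]; exists y.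
  by move=> [y _ yr]; rewrite in_itv/=; apply/ereal_inf_ltP; eexists; [exists y|].
apply: bigcup_open => y _; have [pN _] := Hproper; move: (pN y).
case: (psi y) => [s _| _|//]; last first.
  rewrite [X in open X](_ : _ = set0); first exact: open0.
  by apply/seteqP; split => x //=; rewrite addye.
have -> : [set x : vec R d | (s%:E + (sqnorm ((y : vec R d) - x) / (2 * lam))%:E < r%:E)%E] =
    (fun x : vec R d => sqnorm ((y : vec R d) - x)) @^-1` [set z | z < (r - s) * (2 * lam)].
  have key q : (s + q / (2 * lam) < r) = (q < (r - s) * (2 * lam)).
    by rewrite -ltr_pdivrMr ?mulr_gt0// ltrBrDl.
  by apply/seteqP; split => x /=; rewrite -EFinD lte_fin key.
by apply: open_comp; [move=> x _; exact: continuous_sqnorm_sub|exact: open_lt].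
Qed.

Lemma measurable_dens_lam : measurable_fun setT (dens_lam psi lam).
Proof.
apply: measurableT_comp => //; apply: measurableT_comp => //.
by apply: measurableT_comp => //; exact: measurable_moreau.
Qed.

(** The finite envelope cancels in the exponents; where psi = +oo both sides are 0. *)
Lemma wlam_dens x : wlam psi lam x * dens_lam psi lam x = dens psi x.
Proof.
have Mx := moreau_fin x; have [pN _] := Hproper.
rewrite /wlam /dens /dens_lam; move: (pN x).
case: (psi x) => [r _| _|//].
  by rewrite -{1}(fineK Mx) -EFinB -EFinN /= -expRD; congr expR; ring.
by rewrite -{1}(fineK Mx) /= mul0r.
Qed.

Lemma wlam_ge0 x : 0 <= wlam psi lam x.
Proof. by rewrite fine_ge0// expeR_ge0. Qed.

End moreau.

(** * Convergence of matrices *)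

Section matrix_cvg.
Context {R : realType} {T : Type} {F : set_system T} {FF : Filter F}.

Lemma cvg_mxP m n (A : T -> 'M[R]_(m, n)) (L : 'M[R]_(m, n)) :
  A x @[x --> F] --> L <-> forall i j, A x i j @[x --> F] --> L i j.
Proof.
split=> [AL i j|H].
  exact: (cvg_comp A (fun M : 'M[R]_(m, n) => M i j) AL (@coord_continuous R m n i j L)).
move=> B [Q HQ QB].
have QA : \forall x \near F, forall i j, Q i j (A x i j).
  by apply: filter_forall => i; apply: filter_forall => j; exact: H.
by apply: (filterS _ QA) => x Hx; exact: QB.
Qed.

Lemma cvg_mulmx m n q (A : T -> 'M[R]_(m, n)) (B : T -> 'M[R]_(n, q))
    (A0 : 'M[R]_(m, n)) (B0 : 'M[R]_(n, q)) :
  A x @[x --> F] --> A0 -> B x @[x --> F] --> B0 ->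
  (A x *m B x) @[x --> F] --> (A0 *m B0).
Proof.
move=> /cvg_mxP HA /cvg_mxP HB; apply/cvg_mxP => i j.
under eq_cvg do rewrite mxE; rewrite mxE.
by apply: cvg_big => [|k _]; [exact: add_continuous|exact: cvgM].
Qed.

Lemma cvg_trmx m n (A : T -> 'M[R]_(m, n)) (A0 : 'M[R]_(m, n)) :
  A x @[x --> F] --> A0 -> (A x)^T @[x --> F] --> A0^T.
Proof.
move=> /cvg_mxP HA; apply/cvg_mxP => i j.
by under eq_cvg do rewrite mxE; rewrite mxE; exact: HA.
Qed.

Lemma cvg_scalemx m n (a : T -> R) (A : T -> 'M[R]_(m, n))
    (a0 : R) (A0 : 'M[R]_(m, n)) :
  a x @[x --> F] --> a0 -> A x @[x --> F] --> A0 ->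
  (a x *: A x) @[x --> F] --> (a0 *: A0).
Proof.
move=> Ha /cvg_mxP HA; apply/cvg_mxP => i j.
by under eq_cvg do rewrite mxE; rewrite mxE; exact: cvgM.
Qed.

Lemma cvg_Amat p (v : T -> 'cV[R]_p) (v0 : 'cV[R]_p) :
  v x @[x --> F] --> v0 -> Amat (v x) @[x --> F] --> Amat v0.
Proof.
move=> /cvg_mxP Hv; apply/cvg_mxP => i j; rewrite /Amat.
case: (split_ordP j) => k ->.
  by under eq_cvg do rewrite row_mxEl; rewrite row_mxEl; exact: cvg_cst.
under eq_cvg do rewrite row_mxEr mxE.
by rewrite row_mxEr mxE; apply: cvgN; exact: Hv.
Qed.

End matrix_cvg.

(** * Consistency of the plug-in estimator *)

Unset Implicit Arguments.

Theorem theorem8 (R : realType) (d p : nat)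
  (leb : {measure set (Rd R d) -> \bar R}) (Hleb : is_lebesgue leb)
  (psi : Rd R d -> \bar R)
  (Hproper : proper_fun psi) (Hclosed : closed_fun psi)
  (Hconvex : convex_fun psi) (Hbdd : bounded_below psi)
  (Hint : (\int[leb]_x expeR (- psi x) < +oo)%E)
  (lam : R) (Hlam : 0 < lam)
  (xi : Rd R d -> 'cV[R]_p)
  (Hxi_meas : forall i, measurable_fun setT (fun x => xi x i ord0))
  (Htheta_fin : forall i,
      leb.-integrable setT (fun x => (xi x i ord0 * dens psi x)%:E))
  (dO : measure_display) (O : measurableType dO) (P : probability O R)
  (X : nat -> O -> Rd R d) (K : R.-pker (Rd R d) ~> (Rd R d))
  (Hchain : markov_chain P X K)
  (Hirr : irreducible K)
  (Haper : aperiodic K (fun A => \int[leb]_(x in A) (dens_lam psi lam x)%:E)%E)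
  (Hharris : harris_recurrent K)
  (Hstat : stationary_dens leb K (dens_lam psi lam))
  (Sigma : 'M[R]_(p + 1))
  (HS2 : forall i, leb.-integrable setT
      (fun x => ((Svec psi lam xi x i ord0) ^+ 2 * dens_lam psi lam x)%:E))
  (HEw : Edens leb (dens_lam psi lam) (wlam psi lam) != 0)
  (HSigma : Sigma_partial leb K psi lam xi n @[n --> \oo] --> Sigma)
  (Sighat : forall n, ('I_n -> Rd R d) -> 'M[R]_(p + 1))
  (Hcons : {ae P, forall w,
      Sighat n (fun t : 'I_n => X t w) @[n --> \oo] --> Sigma}) :
  let theta : 'cV[R]_p :=
    \col_i Edens leb (dens psi) (fun x => xi x i ord0) in
  let Xi : 'M[R]_p :=
    (Edens leb (dens_lam psi lam) (wlam psi lam)) ^-2 *: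
      (Amat theta *m Sigma *m (Amat theta)^T) in
  let wbar n w := n%:R^-1 * \sum_(t < n) wlam psi lam (X t w) in
  let thetahat n w : 'cV[R]_p :=
    (\sum_(k < n) wlam psi lam (X k w))^-1 *:
      \sum_(t < n) (wlam psi lam (X t w) *: xi (X t w)) in
  let Xihat n w : 'M[R]_p :=
    (wbar n w) ^-2 *:
      (Amat (thetahat n w) *m Sighat n (fun t : 'I_n => X t w)
         *m (Amat (thetahat n w))^T) in
  {ae P, forall w, Xihat n w @[n --> \oo] --> Xi}.
Proof.
move=> theta Xi wbar thetahat Xihat.
set g := dens_lam psi lam in Hstat HS2 HEw *; set w := wlam psi lam in HEw *.
have mg : measurable_fun setT g by exact: measurable_dens_lam.
have g0 x : 0 <= g x by exact: expR_ge0.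
pose pim : {measure set (Rd R d) -> \bar R} := mdensity leb mg g0.
pose S i x := Svec psi lam xi x i ord0.
have SL i x : S (lshift 1 i) x = w x * xi x i ord0.
  by rewrite /S /Svec col_mxEu mxE.
have SR x : S (rshift p ord0) x = w x.
  by rewrite /S /Svec col_mxEd mxE eqxx mulr1n.
(* Measurability of w is extracted from the integrability of w^2 g: multiplying by exp(psi^lambda)
   removes g, and w is the square root of what is left because w >= 0. *)
have mw : measurable_fun setT w.
  have /measurable_int/measurable_EFinP m1 := HS2 (rshift p ord0).
  have -> : w = fun x => Num.sqrt (S (rshift p ord0) x ^+ 2 * g x *
      expR (fine (moreau psi lam x))).
    apply/funext => x; rewrite SR /g /dens_lam -mulrA -expRD addNr expR0 mulr1.
    by rewrite sqrtr_sqr ger0_norm// wlam_ge0.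
  apply: measurableT_comp; first by apply: continuous_measurable_fun; exact: sqrt_continuous.
  apply: measurable_funM => //; apply: measurableT_comp => //.
  by apply: measurableT_comp => //; exact: measurable_moreau.
have mS i : measurable_fun setT (S i).
  case: (split_ordP i) => k ->.
    rewrite (_ : S _ = fun x => w x * xi x k ord0); last by apply/funext => x; rewrite SL.
    exact: measurable_funM.
  rewrite (_ : S _ = w)//; apply/funext => x.
  by rewrite (ord1 k) SR.
(* Division by 0 gives 0, so a nonzero E(w) forces the integral of g to be nonzero. Since [fine]
   sends +oo to 0, this excludes both zero and infinite mass for [pim]. *)
have Eg0 : Rintegral leb setT g != 0.
  by apply: contraNneq HEw => Eg; rewrite /Edens Eg invr0 mulr0.
have pimE : fine (pim setT) = Rintegral leb setT g by [].
have pimoo : (pim setT < +oo)%E.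
  rewrite ltey; apply: contraNN Eg0 => /eqP H.
  by rewrite -pimE H.
have pim0 : (0 < pim setT)%E.
  rewrite lt0e measure_ge0 andbT; apply: contraNN Eg0 => /eqP H.
  by rewrite -pimE H.
have Kpim A : measurable A -> (\int[pim]_x K x A = pim A)%E.
  move=> mA; rewrite ge0_integral_mdensity//; last exact: measurable_kernel.
  exact: Hstat.
have Cov_diag i k : Cov_lag leb K psi lam xi k i i =
    Rintegral pim setT (fun x => S i x * iter k (Kop K) (S i) x) / fine (pim setT) -
    (Rintegral pim setT (S i) / fine (pim setT)) ^+ 2.
  rewrite mxE pimE !Rintegral_mdensity ?expr2//.
  apply: measurable_funM => //; elim: k => //= k IH; exact: measurable_Kop.
have slln i : {ae P, forall o, (n%:R^-1 * \sum_(t < n) S i (X t o)) @[n --> \oo] -->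
    Edens leb g (S i)}.
  have HSii : Sigma_partial leb K psi lam xi n i i @[n --> \oo] --> Sigma i i.
    by move/cvg_mxP : HSigma.
  (* Convergence of the diagonal entries is used only through their boundedness; the bound holds for
     every number exceeding B, hence the choice B + 1. *)
  have [B [_ HB]] := cvg_seq_bounded (cvgP _ HSii).
  have -> : Edens leb g (S i) = Rintegral pim setT (S i) / fine (pim setT).
    by rewrite /Edens pimE Rintegral_mdensity.
  apply: (@harris_slln _ _ K pim Kpim pim0 pimoo (S i)
    (fun k => Cov_lag leb K psi lam xi k i i) (B + 1)) => //.
    apply: (@integrable_mdensity _ _ _ leb g mg g0 (fun x => S i x ^+ 2)).
      exact: measurable_funX.
    exact: HS2.
  (* A lag matrix and its transpose share their diagonal, so this entry of [Sigma_partial] at N is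
     exactly c_0 + 2 (c_1 + ... + c_N). *)
  move=> N; apply: le_trans (ler_norm _) _.
  have := HB (B + 1); rewrite ltrDl ltr01 => /(_ isT N Logic.I) /=.
  rewrite /Sigma_partial mxE summxE big_add1 big_mkord mulr_sumr => HN.
  apply: le_trans HN; rewrite le_eqVlt; apply/orP; left; apply/eqP.
  congr (`|_ + _|); apply: eq_bigr => k _.
  by rewrite [RHS]mxE [X in _ = _ + X]mxE mulrDl mul1r.
have Ew0 : Edens leb g w != 0 by [].
(* The normalizing integral of g cancels in the ratio of the two expectations, leaving numerator and
   denominator of the expectation under pi. *)
have thetaE i : theta i ord0 = (Edens leb g w)^-1 * Edens leb g (S (lshift 1 i)).
  rewrite mxE /Edens.
  have -> : Rintegral leb setT (fun x => w x * g x) = Rintegral leb setT (dens psi).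
    by apply: eq_Rintegral => x _; exact: wlam_dens.
  have -> : Rintegral leb setT (fun x => S (lshift 1 i) x * g x) =
      Rintegral leb setT (fun x => xi x i ord0 * dens psi x).
    apply: eq_Rintegral => x _.
    by rewrite SL mulrAC mulrC; congr (_ * _); exact: wlam_dens.
  by rewrite invf_div [RHS]mulrC [RHS]mulrA divfK.
have all_slln : {ae P, forall o i, (n%:R^-1 * \sum_(t < n) S i (X t o)) @[n --> \oo] -->
    Edens leb g (S i)}.
  by apply: filter_forall => i; exact: slln.
apply: filterS2 all_slln Hcons => o Ho HSig.
have wE n : wbar n o = n%:R^-1 * \sum_(t < n) S (rshift p ord0) (X t o).
  by congr (_ * _); apply: eq_bigr => t _; rewrite SR.
have Hw : wbar n o @[n --> \oo] --> Edens leb g w.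
  have := Ho (rshift p ord0).
  rewrite (_ : S (rshift p ord0) = w); last by apply/funext => x; exact: SR.
  exact.
have Hth : thetahat n o @[n --> \oo] --> theta.
  apply/cvg_mxP => i j; rewrite (ord1 j) thetaE.
  have -> : (fun n => thetahat n o i ord0) = (fun n => (wbar n o)^-1 *
      (n%:R^-1 * \sum_(t < n) S (lshift 1 i) (X t o))).
    apply/funext => n; rewrite mxE summxE.
    have -> : \sum_(t < n) (w (X t o) *: xi (X t o)) i ord0 =
        \sum_(t < n) S (lshift 1 i) (X t o).
      by apply: eq_bigr => t _; rewrite mxE SL.
    (* The two factors 1/n cancel only for n > 0; at n = 0 both sides vanish as empty sums. *)
    case: n => [|n]; first by rewrite !big_ord0 !mulr0.
    by rewrite /wbar invfM invrK mulrACA divff ?mul1r ?pnatr_eq0.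
  by apply: cvgM; [exact: cvgV|exact: Ho].
apply: cvg_scalemx; first by apply: cvgV; [rewrite expf_neq0|exact: cvgM].
apply: cvg_mulmx; last by apply: cvg_trmx; exact: cvg_Amat.
by apply: cvg_mulmx => //; exact: cvg_Amat.
Qed.
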